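(* Let $\nu\in(1,2)$ and $\mu=2-\nu\in(0,1)$, and let $f\in H^{-1}(\Lambda)$. Let $u$ be determined by: $v:=I_+^\mu u\in H_0^1(\Lambda)$ satisfies $$(Dv,Dw)=(f,w)\quad\forall w\in H_0^1(\Lambda).$$ Let $u_N\in V_N$ be determined by: $v_N:=I_+^\mu u_N\in\mathcal P_N^0$ satisfies $$(Dv_N,Dw_N)=(f,w_N)\quad\forall w_N\in\mathcal P_N^0.$$ If $I_+^\mu u\in H_0^1(\Lambda)$ and $(1-x^2)^{(m-1)/2}D_+^{m-\mu}u\in L^2(\Lambda)$ with $m\in\mathbb N$, then $$\|D_+^{1-\mu}(u-u_N)\|\le cN^{1-m}\|D_+^{m-\mu}u\|_{\omega^{(m-1,m-1)}}.$$ In particular, if $f^{(m-2)}\in L^2_{\omega^{(m-1,m-1)}}(\Lambda)$ with $m\ge2$, then $$\|D_+^{1-\mu}(u-u_N)\|\le cN^{1-m}\|f^{(m-2)}\|_{\omega^{(m-1,m-1)}}.$$ Here $c$ is a positive constant independent of $N$ and $u$.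
   Context: $\mathbb N=\{1,2,\dots\}$, $\Lambda=(-1,1)$, $D=d/dx$, $\omega^{(a,b)}(x)=(1-x)^a(1+x)^b$; $(\cdot,\cdot)$ and $\|\cdot\|$ are the $L^2(\Lambda)$ inner product and norm ($(f,w)$ also denotes the duality pairing), and $\|u\|_\varpi=(\int_\Lambda u^2\varpi\,dx)^{1/2}$. $H^1_0(\Lambda)=\{u\in H^1(\Lambda):u(\pm1)=0\}$, with dual $H^{-1}(\Lambda)$. $\mathcal P_N$ is the set of real polynomials of degree at most $N$, and $\mathcal P_N^0=\mathcal P_N\cap H_0^1(\Lambda)$. Right fractional integral, for $\rho>0$: $I_+^\rho v(x)=\frac1{\Gamma(\rho)}\int_x^1\frac{v(y)}{(y-x)^{1-\rho}}dy$. Right Riemann–Liouville derivative, for $s\in[k-1,k)$, $k\in\mathbb N$: $D_+^sv=(-1)^kD^kI_+^{k-s}v$. From $v=I_+^\mu u$ one recovers $u=D_+^\mu v$. The finite-dimensional space is $$V_N=\{\phi=(1-x)^{1-\mu}\psi:\psi\in\mathcal P_{N-1},\ I_+^\mu\phi(-1)=0\};$$ $I_+^\mu$ is an isomorphism from $V_N$ onto $\mathcal P_N^0$.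
   Formalization: The estimates are stated for N ≥ 1 with m ≤ N+1; for m > N+1 they fail, e.g. m=3, N=1, f=2, v=1−x²: the right-hand sides vanish but the error does not. *)

(* Defs.v *)
From HB Require Import structures.
From mathcomp Require Export all_boot all_order all_algebra.
From mathcomp Require Export all_classical all_reals all_analysis.
Export numFieldNormedType.Exports.
Import Order.TTheory GRing.Theory Num.Theory.
Set Implicit Arguments.
Unset Strict Implicit.
Unset Printing Implicit Defensive.
Local Open Scope classical_set_scope.
Local Open Scope ring_scope.

(* Functions on (-1,1) are total functions R -> R whose values outside (-1,1)
   are irrelevant, except for test functions, which vanish there.
   Measurability is with respect to the Borel sets, so an element of L^2 is
   given by a Borel representative. *)

Definition Lam {R : realType} : set R := `]-1, 1[.

Definition jacobi_weight {R : realType} (a b x : R) : R :=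
  (1 - x) `^ a * (1 + x) `^ b.

(* Weighted norms take values in \bar R, so that an infinite norm is never
   read as 0. *)
Definition wL2norm {R : realType} (w g : R -> R) : \bar R :=
  ((\int[@lebesgue_measure R]_(x in Lam) (g x ^+ 2 * w x)%:E) `^ 2^-1)%E.

Definition in_wL2 {R : realType} (w g : R -> R) : Prop :=
  measurable_fun Lam g /\ (wL2norm w g < +oo)%E.

Definition L2norm {R : realType} (g : R -> R) : \bar R := wL2norm (cst 1) g.

Definition in_L2 {R : realType} (g : R -> R) : Prop := in_wL2 (cst 1) g.

Definition L2dot {R : realType} (g h : R -> R) : R :=
  Rintegral (@lebesgue_measure R) Lam (fun x => g x * h x).

Definition test_function {R : realType} (phi : R -> R) : Prop :=
  (forall (n : nat) (x : R), derivable (derive1n n phi) x 1) /\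
  (exists a b : R, [/\ -1 < a, b < 1 &
     forall x : R, ~ (a <= x <= b) -> phi x = 0]).

(* D^k T = g in the sense of distributions on (-1,1). *)
Definition is_distr_deriv {R : realType} (k : nat) (T : (R -> R) -> R)
    (g : R -> R) : Prop :=
  locally_integrable Lam g /\
  (forall phi : R -> R, test_function phi ->
     L2dot g phi = (-1) ^+ k * T (derive1n k phi)).

(* D^k v = g, where v is identified with the distribution it induces. *)
Definition is_weak_deriv {R : realType} (k : nat) (v g : R -> R) : Prop :=
  locally_integrable Lam v /\ is_distr_deriv k (L2dot v) g.

Definition in_H1 {R : realType} (v : R -> R) : Prop :=
  in_L2 v /\ (exists2 dv : R -> R, is_weak_deriv 1 v dv & in_L2 dv).

(* The boundary values are those of the continuous representative. *)
Definition in_H10 {R : realType} (v : R -> R) : Prop :=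
  in_H1 v /\
  (exists w : R -> R, [/\ {within `[-1, 1], continuous w},
     {ae @lebesgue_measure R, forall x, Lam x -> v x = w x},
     w (-1) = 0 & w 1 = 0]).

(* Continuous linear functionals on H^1_0.  Linearity and boundedness force f
   to take equal values on functions that agree almost everywhere on (-1,1). *)
Definition in_Hm1 {R : realType} (f : (R -> R) -> R) : Prop :=
  (forall (a : R) (w1 w2 : R -> R), in_H10 w1 -> in_H10 w2 ->
     f (fun x => a * w1 x + w2 x) = a * f w1 + f w2) /\
  (exists C : R, forall w dw : R -> R, in_H10 w -> is_weak_deriv 1 w dw ->
     (`|f w|%:E <=
        C%:E * (L2norm w `^ 2 + L2norm dw `^ 2) `^ 2^-1)%E).

Definition Euler_Gamma {R : realType} (rho : R) : R :=
  Rintegral (@lebesgue_measure R) `]0, +oo[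
    (fun t => t `^ (rho - 1) * expR (- t)).

(* Right fractional integral I_+^rho. *)
Definition frac_int {R : realType} (rho : R) (v : R -> R) (x : R) : R :=
  (Euler_Gamma rho)^-1 *
  Rintegral (@lebesgue_measure R) `]x, 1[
    (fun y => v y / (y - x) `^ (1 - rho)).

(* D_+^s v = g for the right Riemann-Liouville derivative
   D_+^s v = (-1)^k D^k I_+^(k-s) v, where k - 1 <= s < k. *)
Definition is_RL_deriv {R : realType} (s : R) (v g : R -> R) : Prop :=
  exists k : nat, [/\ (0 < k)%N, k%:R - 1 <= s, s < k%:R &
    is_weak_deriv k (frac_int (k%:R - s) v) (fun x => (-1) ^+ k * g x)].

Definition in_PN0 {R : realType} (N : nat) (w : R -> R) : Prop :=
  (exists2 p : {poly R}, (size p <= N.+1)%N & forall x, Lam x -> w x = p.[x]) /\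
  in_H10 w.

Definition in_VN {R : realType} (mu : R) (N : nat) (phi : R -> R) : Prop :=
  (exists2 psi : {poly R}, (size psi <= N)%N &
     forall x, Lam x -> phi x = (1 - x) `^ (1 - mu) * psi.[x]) /\
  frac_int mu phi (-1) = 0.

(* v in X and (Dv, Dw) = (f, w) for all w in X, where X is a subspace of H^1_0;
   weak derivatives exist there and are unique up to null sets, so the integral
   does not depend on the representatives dv and dw. *)
Definition variational_sol {R : realType} (X : (R -> R) -> Prop)
    (f : (R -> R) -> R) (v : R -> R) : Prop :=
  X v /\
  (forall w dv dw : R -> R, X w -> is_weak_deriv 1 v dv ->
     is_weak_deriv 1 w dw -> L2dot dv dw = f w).

(* Main.v *)
(** Put v = I_+^mu u, h = Dv and k = m - 1.  By Galerkin orthogonality, and since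
    Dv and Dv_N have mean zero, Dv_N is the L^2 projection of h on the polynomials
    of degree less than N, so the error is the tail of the Legendre series of h.
    The Legendre polynomials are the eigenfunctions of the symmetric operator
    A p = (-1)^k D^k (omega^k D^k p), omega = 1 - x^2, with eigenvalues
    lambda_n = (n+k)!/(n-k)!.  Moving D^k from omega^k D^k p to h turns (h, A p)
    into (D^k h, omega^k D^k p) up to sign; with A p a block of the Legendre series
    this bounds the square of its norm by the weighted norm of D^k h = D^m v,
    squared, over lambda_N, and lambda_N >= N^(2k) / k^k.  Density of the
    polynomials in L^2 lets the block exhaust the tail. *)

Require Import Defs.
From mathcomp Require Import ring lra zify.
From mathcomp Require Import measurable_realfun lebesgue_integral_differentiation.
Import Order.TTheory GRing.Theory Num.Theory.
Set Implicit Arguments.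
Unset Strict Implicit.
Unset Printing Implicit Defensive.
Local Open Scope classical_set_scope.
Local Open Scope ring_scope.

(** The obstacle is the integration by parts. A weak derivative may be tested only against smooth
    functions with compact support in (-1,1), while omega^k D^k p merely vanishes to order k at the
    end points, and D^k h is controlled only in a weight that degenerates there. Cutoffs of the form
    chi(n omega) bridge the gap: each derivative that falls on the cutoff brings a factor n omega',
    and one of the k factors omega pays for the n because t chi'(t) is bounded. So k derivatives
    stay bounded uniformly in n, and dominated convergence applies. Both estimates reduce to one
    identity (h, D^k phi) = s (g, phi) for test functions phi, with a sign s. In the first it comes
    from weak derivatives of v; in the second the variational equation evaluates f at D^(m-2) phi.
    The error D_+^(1-mu) (u - u_N) is identified with Dv_N - Dv. This requires additivity of I_+^mu,
    which is obtained almost everywhere from Fubini's theorem. *)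

Notation leb := (@lebesgue_measure _).
Notation integrable_Lam f := (leb.-integrable Lam (EFin \o f)).
Notation int_Lam f := (Rintegral leb Lam f).

(** * Integration on (-1,1) *)

Section IntegralsOnLam.
Context {R : realType}.
Implicit Types (f g h : R -> R) (p q : {poly R}).

Lemma measurable_Lam : measurable (@Lam R).
Proof. exact: measurable_itv. Qed.

Lemma open_Lam : open (@Lam R).
Proof. exact: itv_open. Qed.

Lemma LamE (x : R) : Lam x = (-1 < x < 1).
Proof. by rewrite /Lam /= in_itv. Qed.

Lemma mu_Lam : (@lebesgue_measure R) Lam = 2%:E.
Proof.
rewrite /Lam lebesgue_measure_itv /= lte_fin ifT; last lra.
by rewrite -EFinD; congr EFin; lra.
Qed.

Lemma mu_Lam_fin : ((@lebesgue_measure R) Lam < +oo)%E.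
Proof. by rewrite mu_Lam ltry. Qed.

Lemma integrable_Lam_meas f : integrable_Lam f -> measurable_fun Lam f.
Proof. by move=> /integrableP[/measurable_EFinP]. Qed.

Lemma integrable_LamD f g : integrable_Lam f -> integrable_Lam g ->
  integrable_Lam (fun x => f x + g x).
Proof. by move=> hf hg; apply: (integrableD _ hf hg); exact: measurable_Lam. Qed.

Lemma integrable_LamB f g : integrable_Lam f -> integrable_Lam g ->
  integrable_Lam (fun x => f x - g x).
Proof. by move=> hf hg; apply: (integrableB _ hf hg); exact: measurable_Lam. Qed.

Lemma integrable_LamZ (a : R) f : integrable_Lam f -> integrable_Lam (fun x => a * f x).
Proof. by move=> hf; apply: (integrableZl _ a hf); exact: measurable_Lam. Qed.

Lemma integrable_Lam_le f g : measurable_fun Lam f -> integrable_Lam g ->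
  (forall x, Lam x -> `|f x| <= g x) -> integrable_Lam f.
Proof.
move=> mf ig fg; apply: (le_integrable _ _ _ ig); first exact: measurable_Lam.
  exact/measurable_EFinP.
move=> x Lx /=; rewrite lee_fin (le_trans (fg x Lx))//; exact: ler_norm.
Qed.

Lemma integrable_Lam_cst (a : R) : integrable_Lam (cst a).
Proof.
apply: measurable_bounded_integrable => //; [exact: measurable_Lam|exact: mu_Lam_fin|].
by exists `|a|; split => // M aM x _ /=; exact: ltW.
Qed.

Lemma bounded_integrable_Lam (M : R) f : measurable_fun Lam f ->
  (forall x, Lam x -> `|f x| <= M) -> integrable_Lam f.
Proof. by move=> mf fM; exact: (integrable_Lam_le mf (integrable_Lam_cst M)). Qed.

Lemma continuous_meas f : continuous f -> measurable_fun Lam f.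
Proof. by move=> cf; apply: measurable_funTS; exact: continuous_measurable_fun. Qed.

Lemma within_bounded f (a b : R) : {within `[a, b], continuous f} ->
  exists M : R, forall x, a <= x <= b -> `|f x| <= M.
Proof.
move=> cf; have /compact_bounded[M [_ h]] :=
  continuous_compact cf (@segment_compact R a b).
exists (M + 1) => x xab; apply: (h (M + 1)); first by rewrite ltrDl.
by exists x => //=; rewrite in_itv.
Qed.

Lemma continuous_Lam_bounded f : continuous f ->
  exists M : R, forall x, Lam x -> `|f x| <= M.
Proof.
move=> cf; have [|M h] := @within_bounded f (-1) 1.
  exact: continuous_subspaceT.
by exists M => x; rewrite LamE => /andP[x1 x2]; apply: h; rewrite !ltW.
Qed.

Lemma continuous_integrable_Lam f : continuous f -> integrable_Lam f.
Proof.
move=> cf; have [M h] := continuous_Lam_bounded cf.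
by apply: (bounded_integrable_Lam (M := M)) => //; exact: continuous_meas.
Qed.

Lemma integral_derive (a b : R) (F f : R -> R) : a < b ->
  (forall x : R, is_derive x 1 F (f x)) -> continuous f ->
  Rintegral (@lebesgue_measure R) `]a, b[ f = F b - F a.
Proof.
move=> ab dF cf.
have cF : continuous F.
  by move=> x; apply: differentiable_continuous; apply/derivable1_diffP; have [] := dF x.
rewrite Rintegral_itv_obnd_cbnd; last first.
  apply: (@integrableS _ _ _ (@lebesgue_measure R) `[a, b]) => //.
    exact: subset_itv_oo_cc.
  by apply: continuous_compact_integrable; [exact: segment_compact|exact: continuous_subspaceT].
rewrite Rintegral_itv_bndo_bndc; last first.
  apply: (@integrableS _ _ _ (@lebesgue_measure R) `[a, b]) => //.
    exact: subset_itv_co_cc.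
  by apply: continuous_compact_integrable; [exact: segment_compact|exact: continuous_subspaceT].
rewrite /Rintegral (continuous_FTC2 ab (F := F))//.
- exact: continuous_subspaceT.
- split => [x _||]; first by have [] := dF x.
  + by apply: cvg_at_right_filter; exact: cF.
  + by apply: cvg_at_left_filter; exact: cF.
- by move=> x _; rewrite derive1E; apply: derive_val.
Qed.

Lemma int_Lam_derive (F f : R -> R) :
  (forall x : R, is_derive x 1 F (f x)) -> continuous f ->
  int_Lam f = F 1 - F (-1).
Proof. by move=> dF cf; rewrite /Lam (integral_derive _ dF cf)//; lra. Qed.

Lemma int_LamD f g : integrable_Lam f -> integrable_Lam g ->
  int_Lam (fun x => f x + g x) = int_Lam f + int_Lam g.
Proof. by move=> hf hg; apply: RintegralD => //; exact: measurable_Lam. Qed.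

Lemma int_LamB f g : integrable_Lam f -> integrable_Lam g ->
  int_Lam (fun x => f x - g x) = int_Lam f - int_Lam g.
Proof. by move=> hf hg; apply: RintegralB => //; exact: measurable_Lam. Qed.

Lemma int_LamZ (a : R) f : integrable_Lam f -> int_Lam (fun x => a * f x) = a * int_Lam f.
Proof. by move=> hf; apply: RintegralZl => //; exact: measurable_Lam. Qed.

Lemma eq_int_Lam f g : (forall x, Lam x -> f x = g x) -> int_Lam f = int_Lam g.
Proof. by move=> fg; apply: eq_Rintegral => x /set_mem/fg. Qed.

Lemma le_int_Lam f g : integrable_Lam f -> integrable_Lam g -> (forall x, Lam x ->
  f x <= g x) ->
  int_Lam f <= int_Lam g.
Proof. by move=> hf hg; apply: (@le_Rintegral _ _ _ leb Lam) => //; exact: measurable_Lam. Qed.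

Lemma int_Lam_ge0 f : (forall x, Lam x -> 0 <= f x) -> 0 <= int_Lam f.
Proof. by move=> h; apply: (@Rintegral_ge0 _ _ _ leb). Qed.

Lemma le_norm_int_Lam f : integrable_Lam f -> `|int_Lam f| <= int_Lam (fun x => `|f x|).
Proof. apply: (@le_normr_Rintegral _ _ _ leb Lam) => //; exact: measurable_Lam. Qed.

Lemma integrable_Lam_norm f : integrable_Lam f -> integrable_Lam (fun x => `|f x|).
Proof. exact: (integrable_norm). Qed.

Lemma int_LamE f : integrable_Lam f -> (int_Lam f)%:E = (\int[leb]_(x in Lam) (f x)%:E)%E.
Proof. by move=> hf; rewrite fineK// integrable_fin_num//; exact: measurable_Lam. Qed.

Lemma int_Lam_ae f g : measurable_fun Lam f -> measurable_fun Lam g ->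
  {ae leb, forall x, Lam x -> f x = g x} -> int_Lam f = int_Lam g.
Proof.
move=> mf mg fg; congr fine; apply: ae_eq_integral => //.
- exact: measurable_Lam.
- exact/measurable_EFinP.
- exact/measurable_EFinP.
- case: fg => A [mA A0 sA]; exists A; split => // x nx; apply: sA => h.
  by apply: nx => Lx; rewrite h.
Qed.

Lemma int_Lam_cvg (F : nat -> R -> R) (f g : R -> R) :
  (forall n, measurable_fun Lam (F n)) -> integrable_Lam g ->
  (forall n x, Lam x -> `|F n x| <= g x) ->
  (forall x, Lam x -> F n x @[n --> \oo] --> f x) ->
  int_Lam (F n) @[n --> \oo] --> int_Lam f.
Proof.
move=> mF ig Fg Ff.
have mf : measurable_fun Lam f.
  by apply: (measurable_fun_cvg (h := F)) => //; exact: measurable_Lam.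
have [] := @dominated_convergence _ _ R leb Lam _
  (fun n => EFin \o F n) (EFin \o f) (EFin \o g).
- exact: measurable_Lam.
- by move=> n; apply/measurable_EFinP; exact: mF.
- exact/measurable_EFinP.
- by apply: aeW => x Lx; apply: cvg_EFin; [exact: nearW|exact: Ff].
- exact: ig.
- by apply: aeW => x n Lx; rewrite lee_fin Fg.
move=> iF _ cF; apply: fine_cvg; apply: cvg_trans cF _.
by rewrite -int_LamE.
Qed.

(** * Square-integrable functions *)

Definition sqint f := measurable_fun Lam f /\ integrable_Lam (fun x => f x ^+ 2).

Lemma sqint_meas f : sqint f -> measurable_fun Lam f. Proof. by case. Qed.

Lemma normrM_le_sqr (a b : R) : `|a * b| <= a ^+ 2 + b ^+ 2.
Proof.
rewrite normrM -[a ^+ 2]real_normK ?num_real// -[b ^+ 2]real_normK ?num_real//.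
nra.
Qed.

Lemma sqintM f g : sqint f -> sqint g -> integrable_Lam (fun x => f x * g x).
Proof.
move=> [mf f2] [mg g2]; apply: (integrable_Lam_le _ (integrable_LamD f2 g2)).
  exact: measurable_funM.
by move=> x _; exact: normrM_le_sqr.
Qed.

Lemma sqint_integrable_Lam f : sqint f -> integrable_Lam f.
Proof.
move=> [mf f2]; apply: (integrable_Lam_le mf (integrable_LamD f2 (integrable_Lam_cst 1))) =>
  x _ /=.
by have := normrM_le_sqr (f x) 1; rewrite mulr1 expr1n.
Qed.

Lemma sqintD f g : sqint f -> sqint g -> sqint (fun x => f x + g x).
Proof.
move=> hf hg; split; first exact: measurable_funD (sqint_meas hf) (sqint_meas hg).
have e : (fun x => (f x + g x) ^+ 2) = fun x => f x ^+ 2 + (2 * (f x * g x) + g x ^+ 2).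
  by apply/funext => x; ring.
by rewrite e; apply: integrable_LamD; [case: hf|apply: integrable_LamD;
  [apply: integrable_LamZ; exact: sqintM|case: hg]].
Qed.

Lemma sqintZ (a : R) f : sqint f -> sqint (fun x => a * f x).
Proof.
move=> [mf f2]; split; first exact: measurable_funM.
by under eq_fun do rewrite exprMn; exact: integrable_LamZ.
Qed.

Lemma sqintB f g : sqint f -> sqint g -> sqint (fun x => f x - g x).
Proof.
move=> hf hg; have /= := sqintD hf (sqintZ (-1) hg).
by under eq_fun do rewrite mulN1r.
Qed.

Lemma bounded_sqint (M : R) f : measurable_fun Lam f ->
  (forall x, Lam x -> `|f x| <= M) -> sqint f.
Proof.
move=> mf fM; split => //; apply: (@bounded_integrable_Lam (M ^+ 2)).
  exact: measurable_funX.
by move=> x /fM h; rewrite normrX lerXn2r// ?nnegrE//; exact: le_trans h.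
Qed.

Lemma continuous_sqint f : continuous f -> sqint f.
Proof.
move=> cf; have [M h] := continuous_Lam_bounded cf.
by apply: (bounded_sqint (M := M)) => //; exact: continuous_meas.
Qed.

Lemma sqint_poly p : sqint (horner p).
Proof. by apply: continuous_sqint => x; exact: continuous_horner. Qed.

End IntegralsOnLam.

(** * Legendre polynomials *)

Section JacobiPolynomials.
Context {R : realType}.
Implicit Types (p q r : {poly R}).

Lemma poly_eq0_Lam p : (forall x, Lam x -> p.[x] = 0) -> p = 0.
Proof.
(* The points 1/(i+2) are [size p] distinct points of (0,1): too many roots for a nonzero p. *)
move=> p0; pose rs := [seq i.+2%:R^-1 : R | i <- iota 0 (size p)].
apply: (@roots_geq_poly_eq0 _ p rs).
- apply/allP => _ /mapP[i _ ->]; apply/rootP/p0; rewrite LamE.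
  by rewrite (lt_trans (ltrN10 _)) ?invr_gt0// invf_lt1// ltr1n.
- rewrite map_inj_uniq ?iota_uniq// => i j /invr_inj/eqP.
  by rewrite eqr_nat => /eqP[].
- by rewrite size_map size_iota.
Qed.

Lemma poly_antideriv q : exists2 P : {poly R}, P^`() = q & (size P <= (size q).+1)%N.
Proof.
exists (\poly_(i < (size q).+1) (q`_i.-1 / i%:R)); last exact: size_poly.
apply/polyP => i; rewrite coef_deriv coef_poly ltnS /=; case: ltnP => [iq|qi].
  by rewrite -[LHS]mulr_natr divfK// pnatr_eq0.
by rewrite mul0rn nth_default.
Qed.

Lemma integrable_Lam_poly p : integrable_Lam (horner p).
Proof. by apply: continuous_integrable_Lam => x; exact: continuous_horner. Qed.

Definition int_poly p : R := int_Lam (horner p).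

Lemma int_poly_deriv p : int_poly p^`() = p.[1] - p.[-1].
Proof. by apply: int_Lam_derive => x; exact: continuous_horner. Qed.

Lemma int_polyD p q : int_poly (p + q) = int_poly p + int_poly q.
Proof.
by rewrite -int_LamD ?integrable_Lam_poly//; apply: eq_int_Lam => x _; rewrite hornerD.
Qed.

Lemma int_polyZ (a : R) p : int_poly (a *: p) = a * int_poly p.
Proof. by rewrite -int_LamZ ?integrable_Lam_poly//; apply: eq_int_Lam => x _;
  rewrite hornerZ. Qed.

Lemma int_poly0 : int_poly 0 = 0.
Proof. by rewrite -[X in int_poly X](scale0r 0) int_polyZ mul0r. Qed.

Lemma int_polyB p q : int_poly (p - q) = int_poly p - int_poly q.
Proof. by rewrite int_polyD -scaleN1r int_polyZ mulN1r. Qed.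

Lemma int_poly_sum (I : Type) (s : seq I) (P : pred I) (F : I -> {poly R}) :
  int_poly (\sum_(i <- s | P i) F i) = \sum_(i <- s | P i) int_poly (F i).
Proof.
exact: (big_morph int_poly int_polyD int_poly0).
Qed.

Lemma int_poly_sqr_ge0 p : 0 <= int_poly (p ^+ 2).
Proof. by apply: int_Lam_ge0 => x _; rewrite horner_exp sqr_ge0. Qed.

(** A primitive P of p^2 is nondecreasing, and the hypothesis says that P(1) = P(-1). Hence P is
    constant on (-1,1), so constant as a polynomial, and p^2 = P' = 0. *)
Lemma int_poly_sqr_eq0 p : int_poly (p ^+ 2) = 0 -> p = 0.
Proof.
have [P PE _] := poly_antideriv (p ^+ 2).
have dP (x : R) : is_derive x 1 (horner P) (p ^+ 2).[x].
  by rewrite -PE; exact: is_derive_poly.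
have h0 (x : R) : 0 <= (p ^+ 2).[x] by rewrite horner_exp sqr_ge0.
have mono (a b : R) : a < b -> P.[a] <= P.[b].
  move=> ab; rewrite -subr_ge0 -(integral_derive ab dP); last first.
    by move=> x; exact: continuous_horner.
  by apply: (@Rintegral_ge0 _ _ _ leb) => x _; exact: h0.
move=> int_poly0; apply/eqP; rewrite -sqrf_eq0 -PE; apply/eqP.
suff /eqP : P - (P.[1])%:P = 0 by rewrite subr_eq0 => /eqP ->; rewrite derivC.
apply: poly_eq0_Lam => x; rewrite LamE => /andP[x1 x2].
move: int_poly0; rewrite -PE int_poly_deriv => int_poly0; rewrite hornerD hornerN hornerC.
by have := mono _ _ x1; have := mono _ _ x2; lra.
Qed.

Definition omega : {poly R} := 1 - 'X^2.

Lemma omega1 : omega.[1] = 0. Proof. by rewrite /omega !hornerE/= expr1n subrr. Qed.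
Lemma omegaN1 : omega.[-1] = 0. Proof. by rewrite /omega !hornerE/= sqrrN expr1n subrr. Qed.
Lemma omegaE (x : R) : omega.[x] = 1 - x ^+ 2. Proof. by rewrite /omega !hornerE. Qed.

Lemma deriv_omegaM n p :
  (omega ^+ n.+1 * p)^`() = omega ^+ n * (omega^`() * p *+ n.+1 + omega * p^`()).
Proof.
rewrite derivM deriv_exp /= exprS; ring.
Qed.

(** Each derivative uses up at most one factor omega. *)
Lemma derivn_omegaM n i p : exists r, (omega ^+ (i + n) * p)^`(n) = omega ^+ i * r.
Proof.
elim: n p => [|n IH] p; first by exists p; rewrite addn0.
by rewrite derivSn addnS deriv_omegaM; exact: IH.
Qed.

Lemma derivn_omegaM_end n p :
  (omega ^+ n.+1 * p)^`(n).[1] = 0 /\ (omega ^+ n.+1 * p)^`(n).[-1] = 0.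
Proof.
have [r] := derivn_omegaM n 1 p; rewrite add1n expr1 => ->.
by rewrite !hornerM omega1 omegaN1 !mul0r.
Qed.

Lemma int_poly_parts n p q :
  int_poly ((omega ^+ n * p)^`(n) * q) = (-1) ^+ n * int_poly (omega ^+ n * p * q^`(n)).
Proof.
elim: n p q => [|n IH] p q; first by rewrite !derivn0 [RHS]mul1r.
have [e1 e2] := derivn_omegaM_end n p.
have := int_poly_deriv ((omega ^+ n.+1 * p)^`(n) * q).
rewrite !hornerM e1 e2 !mul0r subrr derivM -derivnS int_polyD => /eqP.
rewrite addr_eq0 => /eqP ->.
(* One of the n+1 factors omega is absorbed into p, so that the induction hypothesis applies to
   omega p and q'. *)
by rewrite exprSr -mulrA IH -derivSn exprSr mulrN1 mulNr -!mulrA.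
Qed.

(** Rodrigues' formula without normalization: (-1)^n 2^n n! times the n-th Legendre polynomial. *)
Definition leg n : {poly R} := (omega ^+ n)^`(n).

Definition jacobi_op k p : {poly R} := (-1) ^+ k *: (omega ^+ k * p^`(k))^`(k).

(** The two falling factorials are n!/(n-k)! and (n+k)!/n!, the factors that the inner and the outer
    k-fold derivative of [jacobi_op] put on the coefficient of degree n. *)
Definition jacobi_eig (k n : nat) : nat := n ^_ k * (n + k) ^_ k.

Lemma int_poly_jacobi_op k p q : int_poly (jacobi_op k p * q)
  = int_poly (omega ^+ k * p^`(k) * q^`(k)).
Proof. by rewrite -scalerAl int_polyZ int_poly_parts mulrA -exprMn mulrNN mul1r expr1n mul1r.
  Qed.

Lemma int_poly_jacobi_opC k p q : int_poly (jacobi_op k p * q) = int_poly (p * jacobi_op k q).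
Proof.
by rewrite int_poly_jacobi_op [p * _]mulrC int_poly_jacobi_op; congr int_poly;
  rewrite -!mulrA [p^`(k) * _]mulrC.
Qed.

(** Integration by parts moves all n derivatives onto q, whose degree is below n. *)
Lemma leg_orth n q : (size q <= n)%N -> int_poly (leg n * q) = 0.
Proof.
move=> qn; have := int_poly_parts n 1 q; rewrite mulr1 => ->.
by rewrite (derivn_poly0 qn) mulr0 int_poly0 mulr0.
Qed.

Lemma coefM_top p q a b : (size p <= a.+1)%N -> (size q <= b.+1)%N ->
  (p * q)`_(a + b) = p`_a * q`_b.
Proof.
move=> pa qb; rewrite coefM.
have ha : (a < (a + b).+1)%N by rewrite ltnS leq_addr.
rewrite (bigD1 (Ordinal ha)) //= addKn big1 ?addr0// => -[i /= hi] /eqP ne.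
have [ia|ai] := leqP i a.
  rewrite [q`__]nth_default ?mulr0//; apply: (leq_trans qb).
  have : i <> a by move=> e; apply: ne; apply: val_inj.
  lia.
by rewrite nth_default ?mul0r// (leq_trans pa).
Qed.

Lemma size_omega_le : (size omega <= 3)%N.
Proof.
by rewrite /omega (leq_trans (size_polyD _ _))// size_poly1 size_polyN size_polyXn.
Qed.

Lemma coef_omega_exp k : (size (omega ^+ k) <= (k + k).+1)%N /\ (omega ^+ k)`_(k + k)
  = (-1) ^+ k.
Proof.
elim: k => [|k [IH1 IH2]]; first by rewrite expr0 size_poly1 coef1.
have -> : (k.+1 + k.+1)%N = (2 + (k + k))%N by lia.
rewrite exprS (coefM_top size_omega_le IH1) IH2; split.
  rewrite (leq_trans (size_polyMleq _ _))//.
  by have := size_omega_le; move: IH1; lia.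
by rewrite exprS; congr (_ * _); rewrite /omega coefB coef1 coefXn/= sub0r.
Qed.

Lemma size_derivn_le k n p : (size p <= n)%N -> (size p^`(k) <= n - k)%N.
Proof.
move=> pn; apply/leq_sizeP => j hj; rewrite coef_derivn nth_default ?mul0rn//.
by rewrite (leq_trans pn)// -leq_subLR.
Qed.

Lemma leg_coef n : (size (leg n) <= n.+1)%N /\ (leg n)`_n != 0.
Proof.
have [h1 h2] := coef_omega_exp n; split.
  by have := size_derivn_le n h1; rewrite subSn ?leq_addl// addnK.
rewrite coef_derivn h2 -[X in X != 0]mulr_natr mulf_neq0//; first by rewrite signr_eq0.
by rewrite pnatr_eq0 -lt0n ffact_gt0 leq_addl.
Qed.

Lemma leg_neq0 n : leg n != 0.
Proof. by have [_] := leg_coef n; apply: contraNneq => ->; rewrite coef0. Qed.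

Lemma size_jacobi_op k p : (size (jacobi_op k p) <= size p)%N.
Proof.
rewrite (leq_trans (size_scale_leq _ _))//.
have [pk|kp] := leqP (size p) k.
  by rewrite (derivn_poly0 pk) mulr0 derivn_poly0 ?size_poly0.
have [h1 _] := coef_omega_exp k.
have h2 := size_derivn_le k (leqnn (size p)).
have h3 := size_polyMleq (omega ^+ k) p^`(k).
have := size_derivn_le k h3; move/leq_trans; apply; move: h1 h2 kp; lia.
Qed.

Lemma jacobi_op_coef k n p : (k <= n)%N -> (size p <= n.+1)%N ->
  (jacobi_op k p)`_n = (jacobi_eig k n)%:R * p`_n.
Proof.
move=> kn pn; rewrite coefZ coef_derivn.
have [h1 h2] := coef_omega_exp k.
have h3 : (size p^`(k) <= (n - k).+1)%N.
  by rewrite -subSn//; exact: size_derivn_le.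
have -> : (k + n = (k + k) + (n - k))%N by lia.
rewrite (coefM_top h1 h3) h2 coef_derivn subnKC//.
have -> : (k + k + (n - k) = n + k)%N by lia.
rewrite /jacobi_eig natrM -[_ *+ (n + k) ^_ k]mulr_natr -[_ *+ n ^_ k]mulr_natr.
have : (-1) ^+ k * (-1) ^+ k = 1 :> R by rewrite -exprMn mulrNN mul1r expr1n.
set s := (-1) ^+ k => ss.
have -> : s * (s * (p`_n * (n ^_ k)%:R) * ((n + k) ^_ k)%:R) =
  (s * s) * ((n ^_ k)%:R * ((n + k) ^_ k)%:R * p`_n) by ring.
by rewrite ss mul1r.
Qed.

(** The leading coefficients cancel in r = A leg_n - lambda_n leg_n, so r has degree below n. As A
    is symmetric and does not raise degrees, [leg_orth] makes r orthogonal to every polynomial of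
    degree below n, hence to itself. *)
Lemma jacobi_op_leg k n : (k <= n)%N ->
  jacobi_op k (leg n) = (jacobi_eig k n)%:R *: leg n.
Proof.
move=> kn; apply/eqP; rewrite -subr_eq0; apply/eqP; apply: int_poly_sqr_eq0.
have [h1 _] := leg_coef n.
set r := _ - _.
have rn : (size r <= n)%N.
  apply/leq_sizeP => j; rewrite leq_eqVlt => /predU1P[<-|nj].
    by rewrite /r coefB jacobi_op_coef// coefZ subrr.
  rewrite nth_default// (leq_trans _ nj)// (leq_trans (size_polyD _ _))//.
  rewrite geq_max size_polyN (leq_trans (size_jacobi_op _ _))//.
  by rewrite (leq_trans (size_scale_leq _ _)).
have -> : r ^+ 2 = jacobi_op k (leg n) * r - (jacobi_eig k n)%:R *: (leg n * r).
  by rewrite scalerAl -mulrBl expr2.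
rewrite int_polyB int_polyZ leg_orth// mulr0 subr0.
rewrite int_poly_jacobi_opC leg_orth//.
exact: leq_trans (size_jacobi_op _ _) rn.
Qed.

Lemma leg_spans n q : (size q <= n)%N ->
  exists c : nat -> R, q = \sum_(i < n) c i *: leg i.
Proof.
elim: n q => [|n IH] q qn.
  by exists (fun=> 0); rewrite big_ord0; apply/eqP; rewrite -size_poly_leq0.
have [h1 h2] := leg_coef n.
pose a := q`_n / (leg n)`_n.
have [|c cE] := IH (q - a *: leg n).
  apply/leq_sizeP => j; rewrite leq_eqVlt => /predU1P[<-|nj].
    by rewrite coefB coefZ /a divfK// subrr.
  rewrite nth_default// (leq_trans _ nj)// (leq_trans (size_polyD _ _))//.
  by rewrite geq_max size_polyN qn (leq_trans (size_scale_leq _ _)).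
exists (fun i => if (i == n)%N then a else c i).
rewrite big_ord_recr /= eqxx -[LHS](subrK (a *: leg n)) cE; congr (_ + _).
by apply: eq_bigr => i _; rewrite (ltn_eqF (ltn_ord i)).
Qed.

Lemma jacobi_eig_mono k n n' : (n <= n')%N -> (jacobi_eig k n <= jacobi_eig k n')%N.
Proof.
have ff i j : (i <= j)%N -> (i ^_ k <= j ^_ k)%N.
  move=> ij; elim: k i j ij => [|k IH] i j ij; first by rewrite !ffactn0.
  by rewrite !ffactnS leq_mul// IH// -!subn1 leq_sub2r.
by move=> nn; rewrite leq_mul ?ff// leq_add2r.
Qed.

(** For j < k <= n one has n <= k (n - j), since k (n - k + 1) - n = (k - 1)(n - k) >= 0; these k
    factors cost k^k. The factors of (n+k)!/n! all exceed n. *)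
Lemma jacobi_eig_ge k n : (k <= n)%N -> (n ^ (k + k) <= k ^ k * jacobi_eig k n)%N.
Proof.
move=> kn; rewrite expnD /jacobi_eig mulnA; apply: leq_mul.
  have : forall j, (j <= k)%N -> (n ^ j <= k ^ j * n ^_ j)%N.
    elim=> [|j IH] jk; first by rewrite ffactn0.
    rewrite !expnSr ffactnSr mulnACA leq_mul ?(IH (ltnW jk))//.
    have : (k * (n - k.-1) <= k * (n - j))%N by rewrite leq_mul2l; lia.
    by apply: leq_trans; case: k kn jk {IH} => // k kn jk; rewrite /=; nia.
  by apply.
have : forall j, (j <= k)%N -> (n ^ j <= (n + k) ^_ j)%N.
  elim=> [|j IH] jk; first by rewrite ffactn0.
  by rewrite expnSr ffactnSr leq_mul ?(IH (ltnW jk))//; lia.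
by apply.
Qed.

Lemma jacobi_eig_gt0 k n : (k <= n)%N -> (0 < jacobi_eig k n)%N.
Proof. by move=> kn; rewrite muln_gt0 !ffact_gt0 kn leq_addl. Qed.

End JacobiPolynomials.

(** * Cutoff functions *)

Section Cutoffs.
Context {R : realType}.
Implicit Types (p q r : {poly R}) (s : seq ({poly R} * {poly R})).

(** Termwise, y^i <= i! exp(y) by the exponential series. *)
Lemma horner_expRN_bounded q :
  exists C : R, 0 <= C /\ forall y, 0 <= y -> `|q.[y]| * expR (- y) <= C.
Proof.
exists (\sum_(i < size q) `|q`_i| * i`!%:R); split.
  by apply: sumr_ge0 => i _; rewrite mulr_ge0.
move=> y y0; rewrite horner_coef expRN ler_pdivrMr ?expR_gt0//.
rewrite (le_trans (ler_norm_sum _ _ _))// mulr_suml; apply: ler_sum => i _.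
rewrite normrM -mulrA ler_wpM2l// ger0_norm ?exprn_ge0//.
case: (nat_of_ord i) => [|n].
  by rewrite expr0 mul1r -expR0 ler_expR.
rewrite [leRHS]mulrC -ler_pdivrMr ?ltr0n ?fact_gt0//.
by rewrite (le_trans _ (expR_ge1Dxn n y0))// lerDr.
Qed.

(* These functions are smooth, vanish for t <= 1 and tend to q(0) at infinity; the
   family is stable under d/dt (dcut) and under t d/dt (cutM_t).  The latter keeps
   the derivatives of cut q (n omega) omega^j p bounded uniformly in n. *)
Definition cut q (t : R) : R :=
  if 1 < t then q.[(t - 1)^-1] * expR (- (t - 1)^-1) else 0.

Lemma cut_le1 q t : t <= 1 -> cut q t = 0.
Proof. by move=> t1; rewrite /cut ltNge t1. Qed.

Lemma cut_gt1 q t : 1 < t -> cut q t = q.[(t - 1)^-1] * expR (- (t - 1)^-1).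
Proof. by move=> t1; rewrite /cut t1. Qed.

Lemma cut_bounded q : exists C : R, 0 <= C /\ forall t, `|cut q t| <= C.
Proof.
have [C [C0 qC]] := horner_expRN_bounded q; exists C; split => // t.
have [t1|t1] := ltP 1 t; last by rewrite cut_le1// normr0.
rewrite cut_gt1// normrM [`|expR _|]ger0_norm ?expR_ge0//; apply: qC.
by rewrite invr_ge0 subr_ge0 ltW.
Qed.

(** Since [cut ('X * q)] is bounded, the factor t - 1 gives continuity at 1. Since [cut q] vanishes
    at 1, [cut ('X * q)] is also its difference quotient there, which settles the derivative at the
    only delicate point. *)
Lemma cutM q t : cut q t = cut ('X * q) t * (t - 1).
Proof.
have [t1|t1] := ltP 1 t; last by rewrite !cut_le1// mul0r.
have t10 : t - 1 != 0 by rewrite subr_eq0 gt_eqF.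
by rewrite !cut_gt1// hornerM hornerX; field.
Qed.

Lemma cut_continuous1 q : {for 1, continuous (cut q)}.
Proof.
have [C [C0 qC]] := cut_bounded ('X * q).
rewrite /prop_for /continuous_at cut_le1//; apply/cvgrPdist_le => e e0.
near=> t; rewrite sub0r normrN cutM normrM.
apply: (@le_trans _ _ ((C + 1) * `|t - 1|)).
  by rewrite ler_wpM2r// (le_trans (qC t))// lerDl.
rewrite -ler_pdivlMl ?ltr_wpDl// distrC.
near: t; apply: cvgr_dist_le; first exact: cvg_id.
by rewrite mulr_gt0// invr_gt0 ltr_wpDl.
Unshelve. all: by end_near. Qed.

(** With y = 1/(t-1), so y' = -y^2, the chain rule turns q(y) exp(-y) into y^2 (q - q')(y)
    exp(-y). *)
Definition dcut q := 'X^2 * (q - q^`()).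

Lemma is_derive_cut q (t : R) : is_derive t 1 (cut q) (cut (dcut q) t).
Proof.
have [t1|t1|<-] := ltgtP 1 t.
- have t10 : t - 1 != 0 by rewrite subr_eq0 gt_eqF.
  pose y (t : R) := (t - 1)^-1.
  have dy : is_derive t 1 y (- (y t) ^+ 2).
    apply: is_derive_eq; first exact: is_deriveV.
    by rewrite /= /GRing.scale /= subr0 mulr1 -exprVn.
  have dq : is_derive t 1 (horner q \o y) (q^`().[y t] * (- (y t) ^+ 2)).
    exact: is_derive1_comp.
  have de : is_derive t 1 (expR \o (- y)) (expR (- y t) * (y t) ^+ 2).
    by apply: is_derive_eq; rewrite opprK.
  have := is_deriveM dq de.
  move=> H; apply: (is_derive_eq (near_eq_is_derive _ H)).
    near=> u; rewrite cut_gt1//.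
    by near: u; exact: lt_nbhsr.
  rewrite cut_gt1// /dcut !hornerE /= /GRing.scale /=; rewrite /y; ring.
- rewrite cut_le1 ?ltW//; apply: near_eq_is_derive (is_derive_cst 0 t 1).
  near=> u; rewrite cut_le1//; apply: ltW.
  by near: u; exact: lt_nbhsl.
- apply/is_derive1_caratheodory; exists (cut ('X * q)); split.
  + by move=> z; rewrite (cut_le1 _ (lexx 1)) subr0 cutM.
  + exact: cut_continuous1.
  + by rewrite !cut_le1.
Unshelve. all: by end_near. Qed.


(** With y = 1/(t-1) one has t = 1 + 1/y, so t y^2 = y^2 + y. The factor X^2 is the one supplied by
    [dcut]. *)
Lemma cutM_t q t : t * cut ('X^2 * q) t = cut (('X^2 + 'X) * q) t.
Proof.
have [t1|t1] := ltP 1 t; last by rewrite !cut_le1// mulr0.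
have t10 : t - 1 != 0 by rewrite subr_eq0 gt_eqF.
by rewrite !cut_gt1// !hornerE /=; field.
Qed.

(** A finite sum encoded by its list of pairs, so that differentiation becomes an operation on
    lists. Bounds and limits uniform in n follow for a list that does not depend on n. *)
Definition cutsum (n : nat) s (x : R) : R :=
  \sum_(a <- s) cut a.1 (n%:R * omega.[x]) * a.2.[x].

Lemma cutsum_cons n a s x :
  cutsum n (a :: s) x = cut a.1 (n%:R * omega.[x]) * a.2.[x] + cutsum n s x.
Proof. by rewrite /cutsum big_cons. Qed.

Lemma cutsum_nil n x : cutsum n [::] x = 0.
Proof. by rewrite /cutsum big_nil. Qed.

Lemma is_derive_cut_horner n q p (x : R) :
  is_derive x 1 (fun y => cut q (n%:R * omega.[y]) * p.[y])
    (cut (dcut q) (n%:R * omega.[x]) * (n%:R * omega^`().[x] * p.[x]) +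
     cut q (n%:R * omega.[x]) * p^`().[x]).
Proof.
pose g := horner (n%:R *: omega : {poly R}).
have dg : is_derive x 1 g (n%:R * omega^`().[x]).
  by apply: is_derive_eq; rewrite derivZ hornerZ.
have dc : is_derive (g x) 1 (cut q) (cut (dcut q) (g x)) := is_derive_cut q (g x).
have dcg := is_derive1_comp dc dg.
have := is_deriveM dcg (is_derive_poly p x).
have -> : ((cut q \o g) * horner p) = (fun y => cut q (n%:R * omega.[y]) * p.[y]).
  by apply/funext => y; rewrite /g /= -hornerZ.
move=> H; apply: is_derive_eq; rewrite /g /= /GRing.scale /= hornerZ; ring.
Qed.

Definition dcutsum n s := flatten
  [seq [:: (dcut a.1, n%:R *: (omega^`() * a.2)); (a.1, a.2^`())] | a <- s].

Lemma is_derive_cutsum n s (x : R) :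
  is_derive x 1 (cutsum n s) (cutsum n (dcutsum n s) x).
Proof.
elim: s => [|[q p] s IH].
  have -> : cutsum n [::] = cst 0 by apply/funext => y; rewrite cutsum_nil.
  exact: is_derive_cst.
have -> : cutsum n ((q, p) :: s) =
    (fun y => cut q (n%:R * omega.[y]) * p.[y]) + cutsum n s.
  by apply/funext => y; rewrite cutsum_cons.
rewrite /dcutsum /= !cutsum_cons /= addrA hornerZ hornerM.
have := is_deriveD (is_derive_cut_horner n q p x) IH.
by rewrite !mulrA.
Qed.

Lemma derive1_cutsum n s : (cutsum n s)^`()%classic = cutsum n (dcutsum n s).
Proof.
apply/funext => x; rewrite derive1E; have := is_derive_cutsum n s x.
by move=> ?; exact: derive_val.
Qed.

Lemma derive1n_cutsum n s k : exists s', derive1n k (cutsum n s) = cutsum n s'.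
Proof.
elim: k => [|k [s' IH]]; first by exists s.
by exists (dcutsum n s'); rewrite derive1nS IH derive1_cutsum.
Qed.

Lemma test_function_cutsum n s : test_function (cutsum n s).
Proof.
split => [k x|].
  have [s' ->] := derive1n_cutsum n s k.
  by have [] := is_derive_cutsum n s' x.
(* Here c = 1/(2(n+1)). Where 1 - c < |x| < 1, n omega <= (n+1)(2c - c^2) <= 1, so every cutoff
   vanishes; n+1 in place of n covers n = 0. *)
have [c [c0 c1 cE]] : exists c : R, [/\ 0 < c, c <= 2^-1 & n.+1%:R * (c *+ 2) = 1].
  have n0 : 0 < n.+1%:R :> R by rewrite ltr0n.
  have n1 : 1 <= n.+1%:R :> R by rewrite ler1n.
  exists (n.+1%:R *+ 2)^-1; split.
  - by rewrite invr_gt0 pmulrn_lgt0.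
  - by rewrite lef_pV2 ?posrE ?pmulrn_lgt0// -[leRHS]mulr_natl; lra.
  - by rewrite mulrnAr -mulrnAl divff// mulrn_eq0/= pnatr_eq0.
pose b : R := 1 - c.
exists (- b), b; split; [rewrite /b; lra|rewrite /b; lra|] => x xb.
have omega1 : n%:R * omega.[x] <= 1.
  rewrite omegaE; have [x1|x1] := leP 1 (x ^+ 2).
    by rewrite (le_trans _ (ler01))// mulr_ge0_le0// subr_le0.
  have bx : b < `|x|.
    by rewrite ltNge; apply/negP; rewrite ler_norml.
  have b0 : 0 <= b by rewrite /b; lra.
  have : b ^+ 2 <= x ^+ 2.
    by rewrite -(real_normK (num_real x)) lerXn2r ?nnegrE// ltW.
  have nn : n%:R <= n.+1%:R :> R by rewrite ler_nat.
  have : n.+1%:R * (1 - b ^+ 2) <= 1.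
    rewrite -[leRHS]cE ler_wpM2l// -subr_ge0 /b.
    have -> : c *+ 2 - (1 - (1 - c) ^+ 2) = c ^+ 2 by ring.
    exact: sqr_ge0.
  nra.
by rewrite /cutsum big1// => a _; rewrite cut_le1// mul0r.
Qed.

Lemma cutsum_bounded s :
  exists C : R, 0 <= C /\ forall n x, Lam x -> `|cutsum n s x| <= C.
Proof.
elim: s => [|[q p] s [C [C0 IH]]].
  by exists 0; split => // n x _; rewrite cutsum_nil normr0.
have [B [B0 qB]] := cut_bounded q.
have [M pM] := continuous_Lam_bounded (@continuous_horner _ p).
exists (B * `|M| + C); split; first by rewrite addr_ge0// mulr_ge0.
move=> n x Lx; rewrite cutsum_cons (le_trans (ler_normD _ _))// lerD ?IH// normrM.
by rewrite ler_pM// (le_trans (pM x Lx))// ler_norm.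
Qed.

(** The pointwise limit of [cutsum n s] inside (-1,1), where n omega tends to infinity. *)
Definition cutlim s : {poly R} := \sum_(a <- s) a.1.[0] *: a.2.

Lemma cut_cvg q (c : R) : 0 < c -> cut q (n%:R * c) @[n --> \oo] --> q.[0].
Proof.
move=> c0.
have h : (n%:R * c - 1 : R) @[n --> \oo] --> +oo.
  apply/cvgryPge => A; near=> n.
  rewrite lerBrDr -ler_pdivrMr//.
  by near: n; exact: nbhs_infty_ger.
have hV : (n%:R * c - 1 : R)^-1 @[n --> \oo] --> (0 : R).
  apply/gtr0_cvgV0; last exact: h.
  by move/cvgryPgt : h; apply.
have : q.[(n%:R * c - 1)^-1] * expR (- (n%:R * c - 1)^-1) @[n --> \oo]
    --> q.[0] * expR (- 0).
  apply: cvgM; first exact: (cvg_comp _ _ hV (@continuous_horner _ q 0)).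
  by apply: (cvg_comp _ _ (cvgN hV)); exact: continuous_expR.
rewrite oppr0 expR0 mulr1; apply: cvg_trans; apply: near_eq_cvg; near=> n.
rewrite cut_gt1// -subr_gt0.
by near: n; move/cvgryPgt : h; apply.
Unshelve. all: by end_near. Qed.

Lemma cutsum_cvg s (x : R) : Lam x ->
  cutsum n s x @[n --> \oo] --> (cutlim s).[x].
Proof.
rewrite LamE => /andP[x1 x2].
have wx : 0 < omega.[x] by rewrite omegaE; nra.
elim: s => [|[q p] s IH].
  rewrite /cutlim big_nil horner0.
  by under eq_fun do rewrite cutsum_nil; exact: cvg_cst.
rewrite /cutlim big_cons hornerD hornerZ.
under eq_fun do rewrite cutsum_cons.
by apply: cvgD => //; apply: cvgM; [exact: cut_cvg|exact: cvg_cst].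
Qed.

Definition omega_mul j s := [seq (a.1, omega ^+ j * a.2) | a <- s] : seq ({poly R} * {poly R}).

(** The point is that s' is independent of n, unlike the list [dcutsum n s]. Differentiating cut q
    (n omega) produces n omega', and one factor omega turns this into t cut'(t) at t = n omega,
    which [cutM_t] rewrites without n. The new terms carry X^2 + X, which vanishes at 0, so they
    leave no trace in the limit, and the limit commutes with the derivatives. *)
Lemma derive1n_cutsum_omega_mul j s : exists s',
  (forall n, derive1n j (cutsum n (omega_mul j s)) = cutsum n s') /\
  cutlim s' = (cutlim (omega_mul j s))^`(j).
Proof.
elim: j s => [|j IH] s; first by exists (omega_mul 0 s).
pose s1 := flatten [seq [:: (('X^2 + 'X) * (a.1 - a.1^`()), omega^`() * a.2);
  (a.1, omega^`() * a.2 *+ j.+1 + omega * a.2^`())] | a <- s].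
have [s' [h1 h2]] := IH s1; exists s'; split.
  move=> n; rewrite /derive1n iterSr -/(derive1n _ _) -h1 derive1_cutsum.
  congr derive1n; apply/funext => x; rewrite /s1 /omega_mul /dcutsum.
  elim: s {IH s1 h1 h2} => [|[q p] s IH]; first by rewrite !cutsum_nil.
  rewrite /= !cutsum_cons IH /= deriv_omegaM; congr (_ + (_ + _)).
  rewrite -cutM_t /dcut [omega ^+ j.+1]exprS hornerZ !hornerM; ring.
rewrite h2 derivSn; congr derivn.
rewrite /cutlim /omega_mul /s1 {IH s1 h1 h2}.
elim: s => [|[q p] s IH]; first by rewrite !big_nil deriv0.
rewrite /= !big_cons /= IH [RHS]derivD derivZ deriv_omegaM.
by rewrite hornerM hornerD horner_exp hornerX expr0n /= addr0 mul0r scale0r add0r.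
Qed.

End Cutoffs.

(** * Weak derivatives *)

Section WeakDerivatives.
Context {R : realType}.
Implicit Types (f g h v phi : R -> R) (p q : {poly R}).

Lemma eq_integrable_Lam f g : (forall x, Lam x -> f x = g x) -> integrable_Lam f ->
  integrable_Lam g.
Proof.
move=> fg; apply: eq_integrable; first exact: measurable_Lam.
by move=> x /set_mem Lx; rewrite /= fg.
Qed.

Lemma eq_meas f g : (forall x, Lam x -> f x = g x) ->
  measurable_fun Lam f -> measurable_fun Lam g.
Proof. by move=> fg; apply: eq_measurable_fun => x /set_mem /fg. Qed.

Lemma wL2norm_lty f (W : R -> R) : measurable_fun Lam f -> measurable_fun Lam W ->
  (forall x, Lam x -> 0 <= W x) ->
  (wL2norm W f < +oo)%E <-> integrable_Lam (fun x => f x ^+ 2 * W x).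
Proof.
move=> mf mW W0; have m2 : measurable_fun Lam (fun x => f x ^+ 2 * W x).
  by apply: measurable_funM => //; exact: measurable_funX.
have e : (\int[leb]_(x in Lam) `|(f x ^+ 2 * W x)%:E| =
          \int[leb]_(x in Lam) (f x ^+ 2 * W x)%:E)%E.
  apply: eq_integral => x /set_mem Lx.
  by rewrite gee0_abs// lee_fin mulr_ge0 ?sqr_ge0 ?W0.
split => [/lty_poweRy|/integrableP[_]] h.
  apply/integrableP; split; first exact/measurable_EFinP.
  by rewrite e; apply: h; rewrite invr_eq0.
by apply: poweR_lty; rewrite -e.
Qed.

Lemma in_L2_sqint f : in_L2 f <-> sqint f.
Proof.
have c (x : R) : Lam x -> 0 <= cst (1 : R) x by move=> _ /=.
split => -[mf h]; split => //.
  move/(wL2norm_lty mf (measurable_cst _ ) c) : h.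
  by under eq_fun do rewrite mulr1.
apply/(wL2norm_lty mf (measurable_cst _ ) c).
by under eq_fun do rewrite mulr1.
Qed.

Lemma integrable_Lam_locally f : integrable_Lam f -> locally_integrable Lam f.
Proof. by move=> h; apply: open_integrable_locally => //; exact: open_Lam. Qed.

Lemma continuous_locally f : continuous f -> locally_integrable Lam f.
Proof. by move=> cf; exact/integrable_Lam_locally/continuous_integrable_Lam. Qed.

Lemma derivable_continuous f : (forall x : R, derivable f x 1) -> continuous f.
Proof.
by move=> df x; apply: differentiable_continuous; apply/derivable1_diffP; exact: df.
Qed.

Lemma test_function_derivable phi : test_function phi ->
  forall n (x : R), derivable (derive1n n phi) x 1.
Proof. by case. Qed.

Lemma test_function_continuous phi n : test_function phi ->
  continuous (derive1n n phi).
Proof. by move=> [h _]; apply: derivable_continuous => x; exact: h. Qed.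

Lemma test_function_end phi : test_function phi -> phi 1 = 0 /\ phi (-1) = 0.
Proof.
by move=> [_ [a [b [a1 b1 h]]]]; split; apply: h => /andP[]; lra.
Qed.

Lemma test_function_derive1 phi : test_function phi -> test_function (phi^`()%classic).
Proof.
move=> [h [a [b [a1 b1 h0]]]]; split.
  move=> n x; have := h n.+1 x; rewrite /derive1n iterSr; exact.
exists a, b; split => // x xab; rewrite derive1E.
have d0 : is_derive x 1 phi 0.
  apply: near_eq_is_derive (is_derive_cst 0 x 1).
  have [xa|ax] := ltP x a.
    near=> y; rewrite /cst h0// => /andP[ay _].
    have : y < a by near: y; exact: lt_nbhsl.
    by rewrite ltNge ay.
  have bx : b < x by rewrite ltNge; apply/negP => xb; apply: xab; rewrite ax xb.
  near=> y; rewrite /cst h0// => /andP[_ yb].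
  have : b < y by near: y; exact: lt_nbhsr.
  by rewrite ltNge yb.
exact: derive_val.
Unshelve. all: by end_near. Qed.

Lemma test_function_derive1n phi n : test_function phi -> test_function (derive1n n phi).
Proof.
elim: n => [//|n IH] /IH h; rewrite derive1nS; exact: test_function_derive1.
Qed.

Lemma int_Lam_parts f f' phi : (forall x : R, is_derive x 1 f (f' x)) ->
  continuous f' -> test_function phi ->
  L2dot f (derive1n 1 phi) = - L2dot f' phi.
Proof.
move=> df cf' tp.
have cf : continuous f by apply: derivable_continuous => x; have [] := df x.
have cp : continuous phi := @test_function_continuous phi 0%N tp.
have cp' : continuous (derive1n 1 phi) := @test_function_continuous phi 1%N tp.
have dp (x : R) : is_derive x 1 phi (derive1n 1 phi x).
  by rewrite derive1n1 derive1E; apply: derivableP;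
    exact: (@test_function_derivable phi tp 0%N x).
have [p1 pN1] := test_function_end tp.
apply/eqP; rewrite -addr_eq0 -int_LamD; last 2 first.
- by apply: continuous_integrable_Lam => x; apply: cvgM; [exact: cf|exact: cp'].
- by apply: continuous_integrable_Lam => x; apply: cvgM; [exact: cf'|exact: cp].
have -> : int_Lam (fun x => f x * derive1n 1 phi x + f' x * phi x) =
    (f * phi) 1 - (f * phi) (-1).
  apply: int_Lam_derive => x.
    by apply: is_derive_eq; rewrite /GRing.scale /= [phi x * _]mulrC.
  apply: cvgD; apply: cvgM; [exact: cf|exact: cp'|exact: cf'|exact: cp].
by rewrite !fctE p1 pN1 !mulr0 subrr.
Qed.

Lemma weak_deriv_classical v f f' : (forall x, Lam x -> v x = f x) ->
  (forall x : R, is_derive x 1 f (f' x)) -> continuous f' ->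
  is_weak_deriv 1 v f'.
Proof.
move=> vf df cf'.
have cf : continuous f by apply: derivable_continuous => x; have [] := df x.
split.
  apply: integrable_Lam_locally;
    apply: eq_integrable_Lam (continuous_integrable_Lam cf) => x Lx.
  by rewrite vf.
split; first exact: continuous_locally.
move=> phi tp; rewrite expr1 mulN1r.
rewrite (_ : L2dot v _ = L2dot f (derive1n 1 phi)).
  by rewrite (int_Lam_parts df cf' tp) opprK.
by apply: eq_int_Lam => x Lx; rewrite vf.
Qed.

Lemma in_H10_classical v f f' : (forall x, Lam x -> v x = f x) ->
  (forall x : R, is_derive x 1 f (f' x)) -> continuous f' ->
  f (-1) = 0 -> f 1 = 0 -> in_H10 v.
Proof.
move=> vf df cf' fN1 f1.
have cf : continuous f by apply: derivable_continuous => x; have [] := df x.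
split; last first.
  exists f; split => //; first exact: continuous_subspaceT.
  exact: aeW.
split.
  apply/in_L2_sqint; have [mf f2] := continuous_sqint cf; split.
    by apply: eq_meas mf => x /vf.
  by apply: eq_integrable_Lam f2 => x Lx; rewrite vf.
exists f'; first exact: weak_deriv_classical df cf'.
by apply/in_L2_sqint; exact: continuous_sqint.
Qed.

Lemma in_H10_test phi : test_function phi -> in_H10 phi.
Proof.
move=> tp; have [p1 pN1] := test_function_end tp.
apply: (@in_H10_classical phi phi (derive1n 1 phi)) => //.
- move=> x; rewrite derive1n1 derive1E; apply: derivableP.
  exact: (@test_function_derivable phi tp 0%N x).
- exact: test_function_continuous.
Qed.

Lemma weak_deriv_test phi : test_function phi -> is_weak_deriv 1 phi (derive1n 1 phi).
Proof.
move=> tp; apply: (@weak_deriv_classical phi phi) => //.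
- move=> x; rewrite derive1n1 derive1E; apply: derivableP.
  exact: (@test_function_derivable phi tp 0%N x).
- exact: test_function_continuous.
Qed.

(* The test functions cut 1 (n omega) omega^k q and their k-th derivatives converge
   boundedly, so the vanishing of omega^k q to order k at the end points replaces
   compact support. *)
Lemma weak_deriv_pairing k (c : R) h g q : integrable_Lam h -> measurable_fun Lam g ->
  integrable_Lam (fun x => g x * (omega ^+ k * q).[x]) ->
  (forall phi, test_function phi -> L2dot h (derive1n k phi) = c * L2dot g phi) ->
  L2dot h (horner (omega ^+ k * q)^`(k)) = c * L2dot g (horner (omega ^+ k * q)).
Proof.
move=> ih mg igq hg; set s := [:: ((1 : {poly R}), q)].
have lims : cutlim (omega_mul k s) = omega ^+ k * q.
  by rewrite /cutlim /omega_mul /s /= big_seq1 /= hornerC scale1r.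
have [s' [ds' lims']] := derive1n_cutsum_omega_mul k s.
rewrite lims in lims'.
have meas n (s0 : seq ({poly R} * {poly R})) : measurable_fun Lam (cutsum n s0).
  by apply: continuous_meas;
    exact: (@test_function_continuous _ 0%N (test_function_cutsum n s0)).
have [C [C0 Cs']] := cutsum_bounded s'.
have [B [B0 Bcut]] := @cut_bounded R 1.
have c1 : (fun n => L2dot h (cutsum n s')) @ \oo --> L2dot h (horner (omega ^+ k * q)^`(k)).
  apply: (@int_Lam_cvg _ _ _ (fun x => C * `|h x|)).
  - by move=> n; apply: measurable_funM => //; exact: integrable_Lam_meas.
  - by apply: integrable_LamZ; exact: integrable_Lam_norm.
  - by move=> n x Lx; rewrite normrM mulrC ler_wpM2r// Cs'.
  - move=> x Lx; apply: cvgM; first exact: cvg_cst.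
    by rewrite -lims'; exact: cutsum_cvg.
have c2 : (fun n => L2dot g (cutsum n (omega_mul k s))) @ \oo -->
    L2dot g (horner (omega ^+ k * q)).
  apply: (@int_Lam_cvg _ _ _ (fun x => B * `|g x * (omega ^+ k * q).[x]|)).
  - by move=> n; apply: measurable_funM.
  - by apply: integrable_LamZ; exact: integrable_Lam_norm.
  - move=> n x Lx; rewrite /omega_mul /s /= cutsum_cons cutsum_nil addr0 /= mulrCA normrM.
    by rewrite ler_wpM2r.
  - move=> x Lx; apply: cvgM; first exact: cvg_cst.
    by rewrite -lims; exact: cutsum_cvg.
have c3 : (fun n => L2dot h (cutsum n s')) @ \oo --> c * L2dot g (horner (omega ^+ k * q)).
  have -> : (fun n => L2dot h (cutsum n s')) = fun n => c * L2dot g (cutsum n (omega_mul k s)).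
    by apply/funext => n; rewrite -(ds' n) hg//; exact: test_function_cutsum.
  by apply: cvgM => //; exact: cvg_cst.
exact: (cvg_unique _ c1 c3).
Qed.

End WeakDerivatives.

(** * Polynomial approximation *)

Section Weierstrass.
Context {R : realType}.
Implicit Types (f g h : R -> R) (p q : {poly R}).

(* At y this is the mean of u over a binomial (n, y) count; conditioning on the
   first trial gives the recursion and makes the moments a one-line induction. *)
Fixpoint bernstein (n : nat) (u : nat -> R) : {poly R} :=
  if n is n'.+1 then (1 - 'X) * bernstein n' u + 'X * bernstein n' (u \o S)
  else (u 0%N)%:P.

Lemma bernstein_le n (u v : nat -> R) (y : R) : 0 <= y <= 1 ->
  (forall i, (i <= n)%N -> u i <= v i) -> (bernstein n u).[y] <= (bernstein n v).[y].
Proof.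
move=> /andP[y0 y1]; elim: n u v => [|n IH] u v uv /=.
  by rewrite !hornerC uv.
rewrite !hornerE lerD// ler_wpM2l ?subr_ge0//.
- by apply: IH => i ni; apply: uv; exact: leqW.
- by apply: IH => i ni; exact: uv.
Qed.

(** Squared bias plus the binomial variance n y (1 - y). The centre c is arbitrary because
    conditioning on a success shifts it by one. *)
Lemma bernstein_moments n (a b c y : R) :
  (bernstein n (fun i => a + b * (i%:R - c) ^+ 2)).[y] =
  a + b * ((n%:R * y - c) ^+ 2 + n%:R * y * (1 - y)).
Proof.
elim: n c => [|n IH] c /=; first by rewrite !hornerE; ring.
rewrite (_ : _ \o S = fun i => a + b * (i%:R - (c - 1)) ^+ 2); last first.
  by apply/funext => i /=; rewrite -natr1; ring.
by rewrite !hornerE !IH -natr1; ring.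
Qed.

(** Uniform continuity in a form that can be averaged against a binomial law: nearby points cost e,
    and for distant ones K (x - y)^2 exceeds twice the bound of f. *)
Lemma continuous_quadratic_modulus f (e : R) : {within `[-1, 1], continuous f} ->
  0 < e -> exists2 K : R, 0 <= K & forall x y, -1 <= x <= 1 -> -1 <= y <= 1 ->
    `|f x - f y| <= e + K * (x - y) ^+ 2.
Proof.
move=> cf e0; have [M fM] := within_bounded cf.
pose P (K x : R) := -1 <= x <= 1 -> forall y, -1 <= y <= 1 ->
  `|f x - f y| <= e + K * (x - y) ^+ 2.
(* The covering form of compactness along K tending to infinity: around each x it suffices to find a
   neighbourhood on which all large K work. *)
have /compact_near_coveringP/(_ R (+oo) P) := @segment_compact R (-1) 1.
case=> [x|K [_ PK]].
  rewrite /= in_itv /= => x1.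
  have /subspace_continuousP/(_ x) := cf; rewrite /= in_itv /= => /(_ x1).
  move=> /cvgrPdist_le/(_ (e / 2)); rewrite divr_gt0// => /(_ isT).
  move=> /nbhs_ballP[d /= d0 hd].
  near=> x' K => /= x'1 y y1.
  have xx' : `|x - x'| < d / 2 by near: x'; apply: nbhsx_ballx; rewrite divr_gt0.
  have K0 : 0 <= K by near: K; exact: nbhs_pinfty_ge.
  have KM : 2 * M / (d / 2) ^+ 2 <= K by near: K; apply: nbhs_pinfty_ge; rewrite num_real.
  have fx' : `|f x - f x'| <= e / 2.
    apply: hd; last by rewrite in_itv.
    by rewrite /ball /= (lt_le_trans xx')//; lra.
  have [x'y|x'y] := ltP `|x' - y| (d / 2).
    have fy : `|f x - f y| <= e / 2.
      apply: hd; last by rewrite in_itv.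
      rewrite /ball /= (splitr d); apply: le_lt_trans (ltrD xx' x'y).
      by rewrite (le_trans _ (ler_normD _ _))// addrA subrK.
    apply: (@le_trans _ _ e); last by rewrite lerDl mulr_ge0 ?sqr_ge0.
    rewrite (splitr e); apply: le_trans (lerD fx' fy).
    by rewrite [`|f x - f x'|]distrC (le_trans _ (ler_normD _ _))// addrA subrK.
  apply: (@le_trans _ _ (2 * M)).
    rewrite mulr2n mulrDl mul1r (le_trans (ler_normB _ _))// lerD// fM//.
  apply: (@le_trans _ _ (K * (d / 2) ^+ 2)).
    by rewrite -ler_pdivrMr ?exprn_gt0 ?divr_gt0.
  apply: ler_wpDl; first exact: ltW.
  rewrite ler_wpM2l// -[leRHS]real_normK ?num_real//.
  by rewrite lerXn2r// nnegrE divr_ge0// ltW.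
have /(_ (`|K| + 1)) := PK.
rewrite (le_lt_trans (ler_norm K)) ?ltrDl// => /(_ isT) H.
exists (`|K| + 1); first by rewrite addr_ge0.
by move=> x y x1 y1; apply: H => //; rewrite /= in_itv.
Unshelve. all: by end_near. Qed.

(** At the nodes, f lies between two quadratics centred at x. [bernstein] is monotone and known
    exactly on quadratics, so its value is squeezed as well. *)
Lemma weierstrass f (e : R) : {within `[-1, 1], continuous f} -> 0 < e ->
  exists p, forall x, -1 <= x <= 1 -> `|f x - p.[x]| <= e.
Proof.
move=> cf e0; have e20 : 0 < e / 2 by rewrite divr_gt0.
have [K K0 fK] := continuous_quadratic_modulus cf e20.
(* The distance from x to a node is 2/n times that from n y to i, and the variance is at most n; the
   quadratic term therefore contributes at most K (2/n)^2 n = 4 K / n. *)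
have [n n0 Kn] : exists2 n : nat, 0 < n%:R :> R & 4 * K / n%:R <= e / 2.
  exists (Num.truncn (4 * K / (e / 2))).+1; first by rewrite ltr0n.
  rewrite ler_pdivrMr ?ltr0n// [leRHS]mulrC -ler_pdivrMr//; apply: ltW.
  exact: truncnS_gt.
pose node (i : nat) : R := i%:R / n%:R *+ 2 - 1.
exists (bernstein n (f \o node) \Po (2^-1 *: ('X + 1))) => x x1.
rewrite horner_comp !(hornerZ, hornerD, hornerX, hornerC); set y := 2^-1 * (x + 1).
have y01 : 0 <= y <= 1 by rewrite /y; case/andP: x1 => ? ?; apply/andP; split; lra.
have xE : x = y *+ 2 - 1 by rewrite /y mulr2n; lra.
have nodeB i : x - node i = - (2 / n%:R) * (i%:R - n%:R * y).
  by rewrite /node xE; field; rewrite gt_eqF.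
have node1 i : (i <= n)%N -> -1 <= node i <= 1.
  move=> ni; have : 0 <= (i%:R / n%:R : R) <= 1.
    by rewrite divr_ge0//= ler_pdivrMr// mul1r ler_nat.
  by rewrite /node mulr2n => /andP[? ?]; apply/andP; split; lra.
have bound i : (i <= n)%N ->
    `|f x - f (node i)| <= e / 2 + 4 * K / n%:R ^+ 2 * (i%:R - n%:R * y) ^+ 2.
  move=> /node1 ni; rewrite (le_trans (fK _ _ x1 ni))// nodeB.
  by rewrite le_eqVlt; apply/orP; left; apply/eqP; field; rewrite gt_eqF.
have var : 4 * K / n%:R ^+ 2 * (n%:R * y * (1 - y)) <= e / 2.
  apply: le_trans Kn.
  have -> : 4 * K / n%:R ^+ 2 * (n%:R * y * (1 - y)) = 4 * K / n%:R * (y * (1 - y)).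
    by field; rewrite gt_eqF.
  rewrite ler_piMr// ?divr_ge0 ?mulr_ge0// ?ltW//.
  by case/andP: y01 => ? ?; nra.
rewrite ler_norml; apply/andP; split.
- rewrite lerBrDl -lerBrDr opprK.
  apply: le_trans (bernstein_le (v := fun i => (f x + e / 2) +
    (4 * K / n%:R ^+ 2) * (i%:R - n%:R * y) ^+ 2) y01 _) _.
    move=> i /bound; rewrite ler_norml => /andP[+ _] /=; lra.
  by rewrite bernstein_moments subrr expr0n add0r; lra.
- rewrite lerBlDl -lerBlDr.
  apply: le_trans (bernstein_le (u := fun i => (f x - e / 2) +
    (- (4 * K / n%:R ^+ 2)) * (i%:R - n%:R * y) ^+ 2) y01 _).
    by rewrite bernstein_moments subrr expr0n add0r; lra.
  by move=> i /bound; rewrite ler_norml => /andP[_] /=; lra.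
Qed.

End Weierstrass.

(** * Density of the polynomials in L^2 *)

Section PolynomialDensity.
Context {R : realType}.
Implicit Types (f g h v phi : R -> R) (p q : {poly R}).

(** Truncation to [-M, M] for M >= 0, written with absolute values so that continuity is
    immediate. *)
Definition clip (M x : R) : R := (`|x + M| - `|x - M|) / 2.

Lemma clip_bounded M x : 0 <= M -> `|clip M x| <= M.
Proof.
by move=> M0; rewrite /clip ler_norml;
  case: (ger0P (x + M)) => ?; case: (ger0P (x - M)) => ?; apply/andP; split; lra.
Qed.

Lemma clip_id M x : `|x| <= M -> clip M x = x.
Proof.
by rewrite ler_norml /clip => /andP[? ?];
  case: (ger0P (x + M)) => ?; case: (ger0P (x - M)) => ?; lra.
Qed.

Lemma clip_lipschitz M x y : `|clip M x - clip M y| <= `|x - y|.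
Proof.
rewrite /clip; have h1 := ler_dist_dist (x + M) (y + M).
have h2 := ler_dist_dist (x - M) (y - M).
have e1 : x + M - (y + M) = x - y by ring.
have e2 : x - M - (y - M) = x - y by ring.
move: h1 h2; rewrite e1 e2 !ler_norml => /andP[? ?] /andP[? ?].
by apply/andP; split; lra.
Qed.

Lemma clip_dist M x : 0 <= M -> `|x - clip M x| <= `|x|.
Proof.
move=> M0; rewrite /clip; case: (ger0P (x + M)) => ?; case: (ger0P (x - M)) => ?;
  case: (ger0P x) => ?; rewrite ler_norml; apply/andP; split; lra.
Qed.

Lemma clip_continuous M f : continuous f -> continuous (clip M \o f).
Proof.
move=> cf x; apply: cvgM; last exact: cvg_cst.
apply: cvgB; apply: cvg_norm; [apply: cvgD|apply: cvgB]; do ?exact: cvg_cst; exact: cf.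
Qed.

Lemma clip_measurable M f : measurable_fun Lam f -> measurable_fun Lam (clip M \o f).
Proof.
move=> mf; apply: (measurableT_comp (f := clip M)) => //.
apply: continuous_measurable_fun; exact: (@clip_continuous M id (fun x => cvg_id)).
Qed.

Lemma clip_approx h (e : R) : sqint h -> 0 < e ->
  exists2 M, 0 < M & int_Lam (fun x => (h x - clip M (h x)) ^+ 2) <= e.
Proof.
move=> [mh h2] e0.
have c : int_Lam (fun x => (h x - clip n%:R (h x)) ^+ 2) @[n --> \oo] --> int_Lam (cst (0 : R)).
  apply: (@int_Lam_cvg _ _ _ (fun x => h x ^+ 2)) => //.
  - move=> n; apply: measurable_funX; apply: measurable_funB => //.
    exact: clip_measurable.
  - move=> n x _; rewrite normrX -[leRHS]real_normK ?num_real//.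
    by rewrite lerXn2r ?nnegrE// clip_dist.
  - move=> x _; apply: cvg_near_cst; near=> n.
    rewrite clip_id ?subrr ?expr0n//.
    by near: n; exact: nbhs_infty_ger.
move/cvgrPdist_le/(_ _ e0) : c => [N _ /(_ N.+1)].
rewrite /Rintegral integral0 sub0r normrN => /(_ (leqnSn N)) H.
exists N.+1%:R; first by rewrite ltr0n.
exact: le_trans (ler_norm _) H.
Unshelve. all: by end_near. Qed.

Lemma continuous_L1_approx f (e : R) : integrable_Lam f -> 0 < e ->
  exists2 g : R -> R, continuous g & int_Lam (fun x => `|f x - g x|) <= e.
Proof.
move=> iF e0.
have [] := @approximation_continuous_integrable R Lam f _ _ iF.
- exact: measurable_Lam.
- exact: mu_Lam_fin.
move=> g [cg ig lim]; have ifg n : integrable_Lam (fun x => `|f x - g n x|).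
  by apply: integrable_Lam_norm; apply: integrable_LamB.
have c : int_Lam (fun x => `|f x - g n x|) @[n --> \oo] --> (0 : R) by exact: fine_cvg lim.
move/cvgrPdist_le/(_ _ e0) : c => [N _ /(_ N (leqnn N))].
rewrite /= sub0r normrN => H; exists (g N) => //.
exact: le_trans (ler_norm _) H.
Qed.

Lemma sqr_sum3 (a b c : R) : (a + b + c) ^+ 2 <= 3 * (a ^+ 2 + b ^+ 2 + c ^+ 2).
Proof.
have h : 3 * (a ^+ 2 + b ^+ 2 + c ^+ 2) - (a + b + c) ^+ 2 =
  (a - b) ^+ 2 + (b - c) ^+ 2 + (a - c) ^+ 2 by ring.
by rewrite -subr_ge0 h !addr_ge0 ?sqr_ge0.
Qed.

(** The continuous approximant g is close in L^1 only. Truncating both h and g at height M upgrades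
    this to L^2, because the squared difference is at most 2 M times the difference. The three
    errors are e/9 each, and [sqr_sum3] costs a factor 3. *)
Lemma poly_dense h (e : R) : sqint h -> 0 < e ->
  exists q, int_Lam (fun x => (h x - q.[x]) ^+ 2) <= e.
Proof.
move=> sh e0; have e9 : 0 < e / 9 by rewrite divr_gt0.
have [M M0 hM] := clip_approx sh e9.
have mc : measurable_fun Lam (clip M \o h) by apply: clip_measurable; case: sh.
have ic : integrable_Lam (clip M \o h).
  by apply: (bounded_integrable_Lam mc) => x _; apply: clip_bounded; exact: ltW.
have [|g cg hg] := continuous_L1_approx ic (_ : 0 < e / 9 / (2 * M)).
  by rewrite divr_gt0// mulr_gt0.
have cg' := @clip_continuous M _ cg.
(* As d <= 1, a uniform error d has square at most d <= e/18, and the interval has length 2. *)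
pose d := Num.min 1 (e / 18).
have d0 : 0 < d by rewrite lt_min ltr01 divr_gt0.
have [q qg] := weierstrass (continuous_subspaceT cg') d0.
exists q.
have s1 : sqint (fun x => h x - clip M (h x)).
  apply: sqintB => //; apply: (bounded_sqint mc) => x _; apply: clip_bounded; exact: ltW.
have s2 : sqint (fun x => clip M (h x) - clip M (g x)).
  apply: sqintB; last exact: continuous_sqint.
  by apply: (bounded_sqint mc) => x _; apply: clip_bounded; exact: ltW.
have s3 : sqint (fun x => clip M (g x) - q.[x]).
  by apply: sqintB; [exact: continuous_sqint|exact: sqint_poly].
have s4 : sqint (fun x => h x - q.[x]) by apply: sqintB => //; exact: sqint_poly.
apply: (@le_trans _ _ (int_Lam (fun x => 3 * ((h x - clip M (h x)) ^+ 2 +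
    (clip M (h x) - clip M (g x)) ^+ 2 + (clip M (g x) - q.[x]) ^+ 2)))).
  apply: le_int_Lam; [by case: s4| |].
    by apply: integrable_LamZ; apply: integrable_LamD; [apply: integrable_LamD;
      [case: s1|case: s2]|case: s3].
  move=> x _; apply: le_trans (sqr_sum3 _ _ _).
  by rewrite le_eqVlt; apply/orP; left; apply/eqP; congr (_ ^+ 2); ring.
rewrite int_LamZ; last by apply: integrable_LamD; [apply: integrable_LamD;
  [case: s1|case: s2]|case: s3].
rewrite int_LamD; [|by apply: integrable_LamD; [case: s1|case: s2]|by case: s3].
rewrite int_LamD; [|by case: s1|by case: s2].
have h2 : int_Lam (fun x => (clip M (h x) - clip M (g x)) ^+ 2) <= e / 9.
  apply: (@le_trans _ _ (int_Lam (fun x => 2 * M * `|clip M (h x) - g x|))).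
    apply: le_int_Lam; [by case: s2| |].
      by apply: integrable_LamZ; apply: integrable_Lam_norm; apply: integrable_LamB => //;
        exact: continuous_integrable_Lam.
    move=> x _; rewrite -real_normK ?num_real// expr2.
    have b1 := @clip_bounded M (h x) (ltW M0).
    have b2 := @clip_bounded M (g x) (ltW M0).
    rewrite ler_pM//.
      rewrite mulr2n mulrDl mul1r (le_trans (ler_normB _ _))// lerD//.
    by rewrite -{1}(clip_id b1) clip_lipschitz.
  rewrite int_LamZ; last by apply: integrable_Lam_norm; apply: integrable_LamB => //;
    exact: continuous_integrable_Lam.
  by rewrite mulrC -ler_pdivlMr// mulr_gt0.
have h3 : int_Lam (fun x => (clip M (g x) - q.[x]) ^+ 2) <= e / 9.
  apply: (@le_trans _ _ (int_Lam (cst (e / 18)))).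
    apply: le_int_Lam; [by case: s3|exact: integrable_Lam_cst|].
    move=> x; rewrite LamE => /andP[x1 x2].
    have /qg : -1 <= x <= 1 by rewrite !ltW.
    rewrite -real_normK ?num_real//= => qx.
    have d1 : d <= 1 by rewrite ge_min lexx.
    have d2 : d <= e / 18 by rewrite ge_min lexx orbT.
    have n0 := normr_ge0 (clip M (g x) - q.[x]).
    by rewrite expr2 (le_trans _ d2)// (le_trans _ qx)// ler_piMr// (le_trans qx).
  rewrite Rintegral_cst; last exact: measurable_Lam.
  by rewrite [X in fine X]mu_Lam /=; lra.
lra.
Qed.

End PolynomialDensity.

(** * Mean value of the derivative of an H^1_0 function *)

Section ZeroMean.
Context {R : realType}.
Implicit Types (f g h v phi : R -> R) (p q : {poly R}).

Lemma cut1_ge0 (t : R) : 0 <= cut 1 t.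
Proof.
have [t1|t1] := ltP 1 t; last by rewrite cut_le1.
by rewrite cut_gt1// hornerC mul1r expR_ge0.
Qed.

Lemma cut1_le1 (t : R) : cut 1 t <= 1.
Proof.
have [t1|t1] := ltP 1 t; last by rewrite cut_le1 ?ler01.
by rewrite cut_gt1// hornerC mul1r expR_le1 oppr_le0 invr_ge0 subr_ge0 ltW.
Qed.

Lemma dcut1_ge0 (t : R) : 0 <= cut (dcut 1) t.
Proof.
have [t1|t1] := ltP 1 t; last by rewrite cut_le1.
rewrite cut_gt1// mulr_ge0 ?expR_ge0// /dcut derivC subr0 mulr1.
by rewrite horner_exp sqr_ge0.
Qed.

(** Test functions with values in [0,1] that tend to 1 on (-1,1): pairing with them recovers the
    integral of a weak derivative. *)
Definition bump (n : nat) : R -> R := cutsum n [:: (1, 1)].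

Lemma bumpE n (x : R) : bump n x = cut 1 (n%:R * omega.[x]).
Proof. by rewrite /bump cutsum_cons cutsum_nil hornerC mulr1 addr0. Qed.

Lemma test_bump n : test_function (bump n).
Proof. exact: test_function_cutsum. Qed.

Lemma is_derive_bump n (x : R) : is_derive x 1 (bump n) (derive1n 1 (bump n) x).
Proof.
rewrite derive1n1 derive1E; apply: derivableP.
exact: (@test_function_derivable _ _ (test_bump n) 0%N x).
Qed.

Lemma derive_bump n (x : R) :
  derive1n 1 (bump n) x = - (n%:R * 2 * x * cut (dcut 1) (n%:R * omega.[x])).
Proof.
rewrite derive1n1 derive1_cutsum /dcutsum /= !cutsum_cons cutsum_nil /=.
rewrite mulr1 derivC horner0 mulr0 !addr0 hornerZ /omega derivB derivC sub0r.
by rewrite derivXn !hornerE /=; ring.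
Qed.

(** [bump n] rises on (-1,0), falls on (0,1) and vanishes at both ends, so this total variation is 2
    [bump n 0]. *)
Lemma int_Lam_abs_derive_bump n : int_Lam (fun x => `|derive1n 1 (bump n) x|) <= 2.
Proof.
have cd : continuous (derive1n 1 (bump n)).
  exact: (@test_function_continuous _ _ 1%N (test_bump n)).
have cdN : continuous (fun x => - derive1n 1 (bump n) x) by move=> x; apply: cvgN; exact: cd.
have ci : integrable_Lam (fun x => `|derive1n 1 (bump n) x|) by apply: integrable_Lam_norm;
  exact: continuous_integrable_Lam.
have LE : @Lam R = `]-1, 0[ `|` `[0, 1[.
  apply/seteqP; split => x; rewrite /Lam /= !in_itv /=.
    move=> /andP[x1 x2]; case: (ltP x 0) => x0; [left|right]; apply/andP; split => //.
  by move=> [/andP[? ?]|/andP[? ?]]; apply/andP; split; lra.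
rewrite {1}LE Rintegral_setU//; last 2 first.
- by rewrite -LE.
- apply/disj_setPS => x [] /=; rewrite !in_itv /= => /andP[_ x0] /andP[x1 _].
  by move: x0; rewrite ltNge x1.
rewrite -Rintegral_itv_obnd_cbnd; last first.
  apply: (@integrableS _ _ _ leb Lam) => //; first exact: measurable_Lam.
  by move=> x; rewrite /Lam /= !in_itv /= => /andP[? ?]; apply/andP; split; lra.
have n2x (x : R) : 0 <= n%:R * 2 * cut (dcut 1) (n%:R * omega.[x]).
  by rewrite !mulr_ge0 ?dcut1_ge0.
have dneg (x : R) : x < 0 -> `|derive1n 1 (bump n) x| = derive1n 1 (bump n) x.
  move=> x0; apply: ger0_norm; rewrite derive_bump mulrAC oppr_ge0.
  by rewrite mulr_ge0_le0// ltW.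
have dpos (x : R) : 0 < x -> `|derive1n 1 (bump n) x| = - derive1n 1 (bump n) x.
  move=> x0; apply: ler0_norm; rewrite derive_bump mulrAC oppr_le0.
  by rewrite mulr_ge0// ltW.
have e1 : Rintegral leb `]-1, 0[ (fun x => `|derive1n 1 (bump n) x|) = bump n 0 - bump n (-1).
  have H : Rintegral leb `]-1, 0[ (derive1n 1 (bump n)) = bump n 0 - bump n (-1).
    by apply: integral_derive => //; exact: is_derive_bump.
  rewrite -{}H.
  apply: eq_Rintegral => x /set_mem; rewrite /= in_itv /= => /andP[_ x0].
  exact: dneg.
have e2 : Rintegral leb `]0, 1[ (fun x => `|derive1n 1 (bump n) x|) = - bump n 1 - - bump n 0.
  have H : Rintegral leb `]0, 1[ (fun x => - derive1n 1 (bump n) x)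
    = (- bump n) 1 - (- bump n) 0.
    apply: integral_derive => // x; apply: is_deriveN; exact: is_derive_bump.
  rewrite -{}H.
  apply: eq_Rintegral => x /set_mem; rewrite /= in_itv /= => /andP[x0 _].
  exact: dpos.
rewrite e1 e2; have [-> ->] := test_function_end (test_bump n).
by rewrite bumpE; have := cut1_le1 (n%:R * omega.[0]); lra.
Qed.

(* Replacing v by a uniformly close polynomial p costs only the total variation of
   bump n, which is bounded uniformly in n. *)
Lemma H10_mean_deriv v dv : in_H10 v -> is_weak_deriv 1 v dv -> integrable_Lam dv ->
  int_Lam dv = 0.
Proof.
move=> [_ [u [cu vu uN1 u1]]] [[mv _ _] [_ wd]] idv.
apply/eqP; rewrite -normr_le0; apply/ler_addgt0Pr => e e0; rewrite add0r.
(* The tolerance e/4 is counted twice through the total variation 2 of [bump n], and once at each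
   end point, where u vanishes. *)
have [|p up] := weierstrass cu (_ : 0 < e / 4); first by rewrite divr_gt0.
have mu' : measurable_fun Lam u.
  apply: subspace_continuous_measurable_fun; first exact: measurable_Lam.
  by apply: continuous_subspaceW cu; exact: subset_itv_oo_cc.
have key n : `|L2dot dv (bump n) - L2dot (horner p^`()) (bump n)| <= e / 2.
  have cb := @test_function_continuous _ _ 0%N (test_bump n).
  have cd := @test_function_continuous _ _ 1%N (test_bump n).
  rewrite wd; last exact: test_bump.
  rewrite expr1 mulN1r.
  have dp (x : R) : is_derive x 1 (horner p) p^`().[x] := is_derive_poly p x.
  have := int_Lam_parts dp (@continuous_horner _ _) (test_bump n).
  move=> /(congr1 -%R); rewrite opprK => <-; rewrite opprK addrC.
  have -> : L2dot v (derive1n 1 (bump n)) = L2dot u (derive1n 1 (bump n)).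
    apply: int_Lam_ae.
    - by apply: measurable_funM => //; exact: continuous_meas.
    - by apply: measurable_funM => //; exact: continuous_meas.
    - case: vu => A [mA A0 sA]; exists A; split => // x nx; apply: sA => h.
      by apply: nx => Lx; rewrite h.
  have ud : integrable_Lam (fun x => (p.[x] - u x) * derive1n 1 (bump n) x).
    apply: (integrable_Lam_le _ (integrable_LamZ (e / 4) (integrable_Lam_norm
      (continuous_integrable_Lam cd)))).
      apply: measurable_funM; last exact: continuous_meas.
      by apply: measurable_funB => //; apply: continuous_meas; exact: continuous_horner.
    move=> x; rewrite LamE => /andP[x1 x2].
    by rewrite normrM ler_wpM2r// distrC up// !ltW.
  have pd : integrable_Lam (fun x => p.[x] * derive1n 1 (bump n) x).
    apply: continuous_integrable_Lam => x; apply: cvgM; [exact: continuous_horner|exact: cd].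
  have ud' : integrable_Lam (fun x => u x * derive1n 1 (bump n) x).
    apply: eq_integrable_Lam (integrable_LamB pd ud) => x _; ring.
  rewrite -int_LamB//.
  rewrite (@eq_int_Lam _ _ (fun x => (p.[x] - u x) * derive1n 1 (bump n) x));
    last by move=> x _; ring.
  rewrite (le_trans (le_norm_int_Lam ud))//.
  apply: (@le_trans _ _ (int_Lam (fun x => e / 4 * `|derive1n 1 (bump n) x|))).
    apply: le_int_Lam; [exact: integrable_Lam_norm|by apply: integrable_LamZ;
      apply: integrable_Lam_norm; exact: continuous_integrable_Lam|].
    move=> x; rewrite LamE => /andP[x1 x2].
    by rewrite normrM ler_wpM2r// distrC up// !ltW.
  rewrite int_LamZ; last by apply: integrable_Lam_norm; exact: continuous_integrable_Lam.
  have -> : e / 2 = e / 4 * 2 by field.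
  by rewrite ler_wpM2l ?divr_ge0 ?(ltW e0)// int_Lam_abs_derive_bump.
have lim f : integrable_Lam f -> L2dot f (bump n) @[n --> \oo] --> int_Lam f.
  move=> iF; rewrite [X in _ --> X](_ : _ = int_Lam (fun x => f x * 1)); last first.
    by apply: eq_int_Lam => x _; rewrite mulr1.
  apply: (@int_Lam_cvg _ _ _ (fun x => `|f x|)).
  - move=> n; apply: measurable_funM; first exact: integrable_Lam_meas.
    by apply: continuous_meas; exact: (@test_function_continuous _ _ 0%N (test_bump n)).
  - exact: integrable_Lam_norm.
  - by move=> n x _; rewrite normrM ler_piMr// bumpE ger0_norm ?cut1_ge0 ?cut1_le1.
  - move=> x Lx; apply: cvgM; first exact: cvg_cst.
    have := @cutsum_cvg R [:: (1, 1)] x Lx.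
    by rewrite /cutlim big_seq1 /= hornerC scale1r hornerC.
have ip : integrable_Lam (horner p^`()) by exact: integrable_Lam_poly.
have : `|int_Lam dv - int_Lam (horner p^`())| <= e / 2.
  apply: (cvgr_to_le (cvg_norm (cvgB (lim _ idv) (lim _ ip)))).
  by apply: nearW => n; exact: key.
have -> : int_Lam (horner p^`()) = p.[1] - p.[-1] by exact: int_poly_deriv.
have h1 : `|p.[1]| <= e / 4.
  by have := up 1; rewrite u1 sub0r normrN; apply; apply/andP; split; lra.
have h2 : `|p.[-1]| <= e / 4.
  by have := up (-1); rewrite uN1 sub0r normrN; apply; apply/andP; split; lra.
by move: h1 h2; rewrite !ler_norml => /andP[? ?] /andP[? ?] /andP[? ?]; apply/andP; split; lra.
Qed.

End ZeroMean.

(** * Error of the Legendre projection *)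

Section LegendreApproximation.
Context {R : realType}.
Implicit Types (f g h : R -> R) (p q : {poly R}).

Lemma int_poly_mul p q : int_poly (p * q) = L2dot (horner p) (horner q).
Proof. by apply: eq_int_Lam => x _; rewrite hornerM. Qed.

Lemma L2dot_polyD h p q : sqint h ->
  L2dot h (horner (p + q)) = L2dot h (horner p) + L2dot h (horner q).
Proof.
move=> sh; rewrite -int_LamD; [|exact: sqintM sh (sqint_poly _)..].
by apply: eq_int_Lam => x _; rewrite hornerD mulrDr.
Qed.

Lemma L2dot_polyZ h (a : R) p : sqint h ->
  L2dot h (horner (a *: p)) = a * L2dot h (horner p).
Proof.
move=> sh; rewrite -int_LamZ; [|exact: sqintM sh (sqint_poly _)].
by apply: eq_int_Lam => x _; rewrite hornerZ mulrCA.
Qed.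

Lemma L2dot_poly_sum h (I : Type) (s : seq I) (P : pred I) (F : I -> {poly R}) :
  sqint h ->
  L2dot h (horner (\sum_(i <- s | P i) F i)) = \sum_(i <- s | P i) L2dot h (horner (F i)).
Proof.
move=> sh; apply: (big_morph (fun p => L2dot h (horner p))).
  by move=> p q; exact: L2dot_polyD.
by rewrite -[X in horner X](scale0r 0) L2dot_polyZ// mul0r.
Qed.

Lemma L2dot_subl f g h : sqint f -> sqint g -> sqint h ->
  L2dot (fun x => f x - g x) h = L2dot f h - L2dot g h.
Proof.
move=> sf sg sh; rewrite -int_LamB; [|exact: sqintM..].
by apply: eq_int_Lam => x _; rewrite mulrBl.
Qed.

Lemma L2dot_pythagoras f g : sqint f -> sqint g -> L2dot f g = 0 ->
  int_Lam (fun x => (f x + g x) ^+ 2)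
    = int_Lam (fun x => f x ^+ 2) + int_Lam (fun x => g x ^+ 2).
Proof.
move=> sf sg fg0; have [_ f2] := sf; have [_ g2] := sg; have ifg := sqintM sf sg.
transitivity (int_Lam (fun x => (f x ^+ 2 + g x ^+ 2) + 2 * (f x * g x))).
  by apply: eq_int_Lam => x _; ring.
rewrite int_LamD; [|exact: integrable_LamD|exact: integrable_LamZ].
by rewrite int_LamD// int_LamZ// [int_Lam (fun x => f x * g x)]fg0 mulr0 addr0.
Qed.

(** Orthogonality is what the Galerkin equations deliver; minimality is derived from it in
    [projection_best]. *)
Definition is_projection (n : nat) h p := (size p <= n)%N /\
  forall q, (size q <= n)%N -> L2dot (fun x => h x - p.[x]) (horner q) = 0.

Lemma projection_best n h p q : sqint h -> is_projection n h p -> (size q <= n)%N ->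
  int_Lam (fun x => (h x - q.[x]) ^+ 2) =
  int_Lam (fun x => (h x - p.[x]) ^+ 2) + int_poly ((p - q) ^+ 2).
Proof.
move=> sh [pn orth] qn.
have s1 : sqint (fun x => h x - p.[x]) by apply: sqintB => //; exact: sqint_poly.
have -> : int_poly ((p - q) ^+ 2) = int_Lam (fun x => (p - q).[x] ^+ 2).
  by apply: eq_int_Lam => x _; rewrite horner_exp.
rewrite -L2dot_pythagoras//; [|exact: sqint_poly|]; last first.
  by apply: orth; rewrite (leq_trans (size_polyD _ _))// geq_max pn size_polyN.
by apply: eq_int_Lam => x _; rewrite hornerD hornerN; congr (_ ^+ 2); ring.
Qed.

Definition leg_coeff h n : R := L2dot h (horner (leg n)) / int_poly (leg n ^+ 2).

Definition leg_sum h n : {poly R} := \sum_(i < n) leg_coeff h i *: leg i.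

Lemma int_poly_leg_sqr_gt0 n : 0 < int_poly (leg n ^+ 2) :> R.
Proof.
rewrite lt_def int_poly_sqr_ge0 andbT; apply/eqP => /int_poly_sqr_eq0 /eqP.
by rewrite (negbTE (leg_neq0 n)).
Qed.

Lemma int_poly_leg_leg i j : i != j -> int_poly (leg i * leg j) = 0 :> R.
Proof.
wlog ij : i j / (i < j)%N => [H|_].
  by rewrite neq_ltn => /orP[ij|ji]; [|rewrite mulrC]; apply: H => //; rewrite ltn_eqF.
rewrite mulrC leg_orth//; have [h _] := @leg_coef R i; exact: leq_trans h ij.
Qed.

Lemma leg_sum_projection h n : sqint h -> is_projection n h (leg_sum h n).
Proof.
move=> sh; split.
  rewrite /leg_sum (leq_trans (size_sum _ _ _))//; apply/bigmax_leqP => i _.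
  rewrite (leq_trans (size_scale_leq _ _))//; have [h1 _] := @leg_coef R i.
  exact: leq_trans h1 (ltn_ord i).
move=> q /leg_spans[c ->].
have s1 : sqint (fun x => h x - (leg_sum h n).[x]) by apply: sqintB => //; exact: sqint_poly.
rewrite L2dot_poly_sum// big1// => j _; rewrite L2dot_polyZ//.
rewrite L2dot_subl//; [|exact: sqint_poly..].
rewrite -int_poly_mul mulr_suml int_poly_sum (bigD1 j)//= big1 ?addr0; last first.
  by move=> i ij; rewrite -scalerAl int_polyZ int_poly_leg_leg ?mulr0.
by rewrite -scalerAl int_polyZ -expr2 divfK ?subrr ?mulr0// gt_eqF// int_poly_leg_sqr_gt0.
Qed.

(* AM-GM, rather than Cauchy-Schwarz, absorbs half of the left-hand side. *)
Lemma leg_block_bound k N M h g : (k <= N)%N -> sqint h -> sqint g ->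
  (forall p, L2dot h (horner (jacobi_op k p)) =
     int_Lam (fun x => g x * (Num.sqrt (omega ^+ k).[x] * p^`(k).[x]))) ->
  int_poly ((\sum_(N <= i < M) leg_coeff h i *: leg i) ^+ 2) <=
    int_Lam (fun x => g x ^+ 2) / (jacobi_eig k N)%:R.
Proof.
move=> kN sh sg hg; set d := \sum_(N <= i < M) _.
have l0 i : (N <= i)%N -> 0 < (jacobi_eig k i)%:R :> R.
  by move=> Ni; rewrite ltr0n jacobi_eig_gt0// (leq_trans kN).
(* The preimage of the block d under [jacobi_op k]; the eigenvalues are positive since k <= N. *)
pose P := \sum_(N <= i < M) (leg_coeff h i / (jacobi_eig k i)%:R) *: leg i : {poly R}.
have opP : jacobi_op k P = d.
  rewrite /P /d; have opD : {morph (@jacobi_op R k) : p q / p + q}.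
    by move=> p q; rewrite /jacobi_op derivnD mulrDr derivnD scalerDr.
  have opZ (a : R) p : jacobi_op k (a *: p) = a *: jacobi_op k p.
    by rewrite /jacobi_op derivnZ -scalerAr derivnZ !scalerA mulrC.
  have op0 : jacobi_op k 0
    = 0 :> {poly R} by rewrite -[X in jacobi_op k X](scale0r 0) opZ scale0r.
  rewrite (big_morph _ opD op0); apply: eq_big_nat => i /andP[Ni iM].
  by rewrite opZ jacobi_op_leg ?(leq_trans kN)// scalerA divfK// gt_eqF// l0.
have dd (F : nat -> R) : int_poly (d * \sum_(N <= i < M) F i *: leg i) =
    \sum_(N <= i < M) leg_coeff h i * F i * int_poly (leg i ^+ 2).
  rewrite /d mulr_suml int_poly_sum; apply: eq_big_nat => i iNM.
  rewrite mulr_sumr int_poly_sum (bigD1_seq i) ?mem_index_iota ?iota_uniq//= big1 ?addr0.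
    by rewrite -scalerAl -scalerAr !int_polyZ mulrA.
  by move=> j ji; rewrite -scalerAl -scalerAr !int_polyZ int_poly_leg_leg ?mulr0// eq_sym.
have hd : L2dot h (horner d) = int_poly (d ^+ 2).
  rewrite expr2 {2}/d dd /d L2dot_poly_sum//; apply: eq_big_nat => i _.
  rewrite L2dot_polyZ// -mulrA; congr (_ * _).
  by rewrite divfK// gt_eqF// int_poly_leg_sqr_gt0.
have dP : int_poly (d * P) <= int_poly (d ^+ 2) / (jacobi_eig k N)%:R.
  rewrite expr2 {3}/d !dd mulr_suml; apply: ler_sum_nat => i /andP[Ni iM].
  move: (leg_coeff h i) (ltW (int_poly_leg_sqr_gt0 i)) => a j0.
  rewrite mulrA [leLHS]mulrAC ler_wpM2l//; first by rewrite mulr_ge0// -expr2 sqr_ge0.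
  rewrite lef_pV2 ?posrE ?l0// ler_nat jacobi_eig_mono//.
pose r x : R := Num.sqrt (omega ^+ k).[x] * P^`(k).[x].
have cr : continuous r.
  move=> x; apply: cvgM; last exact: continuous_horner.
  apply: (continuous_comp (f := horner (omega ^+ k))); first exact: continuous_horner.
  exact: sqrt_continuous.
have sr : sqint r by exact: continuous_sqint.
have [_ g2] := sg; have [_ r2] := sr; have igr := sqintM sg sr.
have X : int_poly (d ^+ 2) = int_Lam (fun x => g x * r x) by rewrite -hd -opP hg.
have Y : int_Lam (fun x => r x ^+ 2) = int_poly (d * P).
  rewrite -opP int_poly_jacobi_op; apply: eq_int_Lam => x; rewrite LamE => /andP[x1 x2].
  have w0 : 0 <= omega.[x] by rewrite omegaE; nra.
  by rewrite /r exprMn sqr_sqrtr ?horner_exp ?exprn_ge0// !hornerM horner_exp expr2 mulrA.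
have lN := l0 N (leqnn N); move: X Y dP lN; set l := (jacobi_eig k N)%:R => X Y dP lN.
(* With l = lambda_N and the integral of r^2 equal to (d, P), expanding gives 2 l |d|^2 <= |g|^2 +
   l^2 (d, P) <= |g|^2 + l |d|^2. *)
have : 0 <= int_Lam (fun x => (g x - l * r x) ^+ 2).
  by apply: int_Lam_ge0 => x _; exact: sqr_ge0.
rewrite (@eq_int_Lam _ _ (fun x => (g x ^+ 2 + (- (2 * l)) * (g x * r x)) + l ^+ 2 * r x ^+
  2)); last first.
  by move=> x _; ring.
rewrite int_LamD; [|by apply: integrable_LamD => //;
  exact: integrable_LamZ|exact: integrable_LamZ].
rewrite int_LamD//; last exact: integrable_LamZ.
rewrite int_LamZ// int_LamZ// -X Y => H.
have : l ^+ 2 * int_poly (d * P) <= l * int_poly (d ^+ 2).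
  rewrite [l ^+ 2]expr2 -mulrA; apply: ler_wpM2l; first exact: ltW.
  by rewrite mulrC -ler_pdivlMr.
by rewrite ler_pdivlMr//; lra.
Qed.

Lemma projection_error k N h g p : (k <= N)%N -> sqint h -> sqint g ->
  (forall q, L2dot h (horner (jacobi_op k q)) =
     int_Lam (fun x => g x * (Num.sqrt (omega ^+ k).[x] * q^`(k).[x]))) ->
  is_projection N h p ->
  int_Lam (fun x => (h x - p.[x]) ^+ 2) <= int_Lam (fun x => g x ^+ 2) / (jacobi_eig k N)%:R.
Proof.
move=> kN sh sg hg prp; apply/ler_addgt0Pr => e e0.
(* M is large enough for q to compete with the projection [leg_sum h M], whose error is then at most
   e. *)
have [q qe] := poly_dense sh e0; pose M := maxn N (size q).
have NM : (N <= M)%N by rewrite leq_maxl.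
have prN := leg_sum_projection N sh; have prM := leg_sum_projection M sh.
have dE : leg_sum h M - leg_sum h N = \sum_(N <= i < M) leg_coeff h i *: leg i.
  rewrite /leg_sum -!(big_mkord xpredT (fun i => leg_coeff h i *: leg i)).
  by rewrite (big_cat_nat (leq0n N) NM) /= addrAC subrr add0r.
(* By minimality the error of p is at most that of [leg_sum h N], for which the block up to M is
   explicit. *)
apply: (@le_trans _ _ (int_Lam (fun x => (h x - (leg_sum h N).[x]) ^+ 2))).
  rewrite (projection_best sh prp (proj1 prN)).
  by rewrite lerDl int_poly_sqr_ge0.
have sizeN : (size (leg_sum h N) <= M)%N by case: prN => h1 _; exact: leq_trans h1 NM.
rewrite (projection_best sh prM sizeN) dE addrC lerD ?leg_block_bound//.
apply: le_trans qe; rewrite (projection_best sh prM (leq_maxr N (size q))).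
by rewrite lerDl int_poly_sqr_ge0.
Qed.

End LegendreApproximation.

(** * Fractional integrals *)

Section FractionalIntegral.
Context {R : realType}.
Implicit Types (f g h u : R -> R).
(** Stopping at b < y keeps away from the singularity x = y, so the fundamental theorem of calculus
    applies with the primitive -(y - x)^rho / rho. The bound does not depend on b, which allows the
    limit b to y by monotone convergence. *)
Lemma frac_kernel_bound_away (rho y b : R) : 0 < rho -> -1 < b -> b < y -> y < 1 ->
  (\int[leb]_(x in `](-1)%R, b[) ((y - x) `^ (rho - 1))%:E <= (2 `^ rho / rho)%:E)%E.
Proof.
move=> rho0 b1 by' y1.
pose F x : R := - ((y - x) `^ rho / rho).
pose f x : R := (y - x) `^ (rho - 1).
have dF (x : R) : x < y -> is_derive x 1 F (f x).
  move=> xy; have yx : 0 < y - x by rewrite subr_gt0.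
  have d1 : is_derive x 1 (fun x : R => y - x) (-1).
    by have := is_deriveB (is_derive_cst y x 1) (is_derive_id x 1); rewrite sub0r.
  have d2 := is_derive1_powR rho yx.
  have d3 := @is_derive1_comp _ (@powR R ^~ rho) (fun x : R => y - x) x _ _ d2 d1.
  have : is_derive x 1 (- rho^-1 \*: ((@powR R ^~ rho) \o (fun x : R => y - x)))
     (- rho^-1 *: (rho * (y - x) `^ (rho - 1) * -1)).
    exact: is_deriveZ.
  rewrite (_ : _ \*: _ = F); last first.
    by apply/funext => z; rewrite /F /= /GRing.scale /= mulNr mulrC.
  by move=> H; apply: is_derive_eq; rewrite /f /GRing.scale /=; field; rewrite gt_eqF.
have cf (x : R) : x < y -> {for x, continuous f}.
  move=> xy; have yx : 0 < y - x by rewrite subr_gt0.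
  apply: (continuous_comp (f := fun x : R => y - x) (g := @powR R ^~ (rho - 1))).
    by apply: cvgB; [exact: cvg_cst|exact: cvg_id].
  apply: differentiable_continuous; apply/derivable1_diffP.
  by have [] := is_derive1_powR (rho - 1) yx.
have cF (x : R) : x < y -> {for x, continuous F}.
  move=> xy; apply: differentiable_continuous; apply/derivable1_diffP.
  by have [] := dF x xy.
have cab : {within `[-1, b], continuous f}.
  apply: continuous_in_subspaceT => x /set_mem; rewrite /= in_itv /= => /andP[_ xb].
  by apply: cf; exact: le_lt_trans by'.
apply: (@le_trans _ _ (\int[leb]_(x in `[(-1)%R, b]) (f x)%:E)%E).
  apply: ge0_subset_integral => //=.
  - apply/measurable_EFinP; exact: subspace_continuous_measurable_fun.
  - by move=> x _; rewrite lee_fin powR_ge0.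
  - exact: subset_itv_oo_cc.
rewrite (continuous_FTC2 (F := F) b1 cab).
- rewrite -EFinB lee_fin /F opprK addrC -mulrBl.
  apply: ler_wpM2r; first by rewrite invr_ge0 ltW.
  apply: (@le_trans _ _ ((y - -1) `^ rho)); first by rewrite gerBl powR_ge0.
  by apply: ge0_ler_powR; rewrite ?nnegrE; lra.
- split=> [x||].
  + rewrite in_itv /= => /andP[_ xb]; have [] := dF x _ => //; exact: lt_trans by'.
  + by apply: cvg_at_right_filter; apply: cF; exact: lt_trans by'.
  + by apply: cvg_at_left_filter; exact: cF.
- move=> x; rewrite in_itv /= => /andP[_ xb]; rewrite derive1E.
  by have ? := dF x (lt_trans xb by'); exact: derive_val.
Qed.

Lemma frac_kernel_bound (rho y : R) : 0 < rho -> -1 < y < 1 ->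
  (\int[leb]_(x in `](-1)%R, y[) ((y - x) `^ (rho - 1))%:E <= (2 `^ rho / rho)%:E)%E.
Proof.
move=> rho0 /andP[y1 y2]; pose F (i : nat) : set R := `]-1, (y - i.+1%:R^-1)[%classic.
have mf : measurable_fun [set: R] (fun x : R => (y - x) `^ (rho - 1)).
  by apply: (measurableT_comp (measurable_powR _)) => //; exact: measurable_funB.
have UF : \bigcup_i F i = `]-1, y[%classic.
  apply/seteqP; split => x /=.
    move=> [i _]; rewrite /F /= !in_itv /= => /andP[-> xi] /=.
    by rewrite (lt_trans xi)// gtrBl invr_gt0.
  rewrite in_itv /= => /andP[x1 xy].
  exists (Num.truncn (y - x)^-1) => //; rewrite /F /= in_itv /= x1 /=.
  rewrite ltrBrDl -ltrBrDr -[ltRHS]invrK ltf_pV2 ?posrE ?invr_gt0 ?subr_gt0//.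
  exact: truncnS_gt.
rewrite -UF; apply: (@closed_cvg _ _ \oo _ (fun i => \int[leb]_(x in F i) ((y - x) `^ (rho -
  1))%:E)%E
    (fun z => z <= (2 `^ rho / rho)%:E)%E).
- exact: closed_ereal_ge_ereal.
- apply: nearW => i; have [yi|yi] := ltP (-1) (y - i.+1%:R^-1).
    by apply: frac_kernel_bound_away => //; rewrite gtrBl invr_gt0.
  rewrite /F set_itv_ge ?integral_set0; last by rewrite bnd_simp -leNgt.
  by rewrite lee_fin divr_ge0 ?powR_ge0// ltW.
  apply: ge0_nondecreasing_set_cvg_integral.
  - move=> i j ij; rewrite subsetEset => x; rewrite /F /= !in_itv /= => /andP[-> xi] /=.
    rewrite (lt_le_trans xi)// lerD2l lerN2 lef_pV2 ?posrE ?ltr0n//.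
    by rewrite ler_nat.
  - by move=> i; exact: measurable_itv.
  - by move=> i; apply/measurable_EFinP; exact: measurable_funTS.
  - by move=> i x _; rewrite lee_fin powR_ge0.
Qed.

(** Here z = (x, y), with the domain -1 < x < y built in so that Fubini's theorem applies on the
    whole plane. The limit y < 1 comes from restricting f to [Lam] in [frac_integrand]. *)
Definition frac_kernel (rho : R) (z : R * R) : R :=
  if (-1 < z.1) && (z.1 < z.2) then (z.2 - z.1) `^ (rho - 1) else 0.

Lemma frac_kernel_ge0 rho z : 0 <= frac_kernel rho z.
Proof. by rewrite /frac_kernel; case: ifP => // _; exact: powR_ge0. Qed.

Lemma measurable_frac_kernel rho : measurable_fun [set: R * R] (frac_kernel rho).
Proof.
apply: measurable_fun_ifT => //.
- apply: measurable_and.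
    by apply: measurable_fun_ltr => //; exact: measurable_fst.
  by apply: measurable_fun_ltr; [exact: measurable_fst|exact: measurable_snd].
- apply: (measurableT_comp (measurable_powR _)) => //.
  by apply: measurable_funB; [exact: measurable_snd|exact: measurable_fst].
Qed.

Definition frac_integrand (rho : R) f (z : R * R) : R := (f \_ Lam) z.2 * frac_kernel rho z.

Lemma measurable_frac_integrand rho f : measurable_fun Lam f ->
  measurable_fun [set: R * R] (frac_integrand rho f).
Proof.
move=> mf; apply: measurable_funM; last exact: measurable_frac_kernel.
apply: (measurableT_comp (f := f \_ Lam)); last exact: measurable_snd.
by apply/(measurable_restrictT _ _).1 => //; exact: measurable_Lam.
Qed.

(** Tonelli with the x-integral inside: for each y it is at most 2^rho / rho, which leaves a
    multiple of the L^1 norm of f. *)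
Lemma integrable_frac_integrand rho f : 0 < rho -> integrable_Lam f ->
  ((@lebesgue_measure R) \x (@lebesgue_measure R))%E.-integrable setT
    (EFin \o frac_integrand rho f).
Proof.
move=> rho0 iF; have mf := integrable_Lam_meas iF.
apply/integrable21ltyP.
  by apply/measurable_EFinP; exact: measurable_frac_integrand.
have mfL : measurable_fun [set: R] (f \_ Lam).
  by apply/(measurable_restrictT _ _).1 => //; exact: measurable_Lam.
apply: (@le_lt_trans _ _
   (\int[leb]_y (`|(f \_ Lam) y|%:E * (2 `^ rho / rho)%:E))%E).
  apply: ge0_le_integral => //.
  - by move=> y _; exact: integral_ge0.
  - have := @measurable_fun_fubini_tonelli_G _ _ _ _ R leb (fun z => `|frac_integrand rho f z|
    %:E)%E.
    apply => //; apply/measurable_EFinP.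
    by apply: measurableT_comp => //; exact: measurable_frac_integrand.
  - by apply: emeasurable_funM => //; apply/measurable_EFinP; exact: measurableT_comp.
  move=> y _.
  have -> : (\int[leb]_x `|(EFin \o frac_integrand rho f) (x, y)|)%E =
      (`|(f \_ Lam) y|%:E * \int[leb]_x (frac_kernel rho (x, y))%:E)%E.
    rewrite -ge0_integralZl//.
    - apply: eq_integral => x _.
      by rewrite /= /frac_integrand /= normrM (ger0_norm (frac_kernel_ge0 _ _)).
    - apply/measurable_EFinP.
      by apply: (measurableT_comp (measurable_frac_kernel rho)); exact: measurable_pair2.
    - by move=> x _; rewrite lee_fin frac_kernel_ge0.
  have [Ly|nLy] := pselect (Lam y); last first.
    by rewrite patchN ?normr0 ?mul0e// notin_setE.
  apply: lee_wpmul2l => //.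
  have y1 : -1 < (y : R) < 1 by rewrite -LamE.
  apply: le_trans (frac_kernel_bound rho0 y1).
  rewrite [leRHS]integral_mkcond le_eqVlt; apply/orP; left; apply/eqP.
  apply: eq_integral => x _; rewrite /frac_kernel patchE mem_setE in_itv /=.
  by case: ifP.
rewrite ge0_integralZr//; last 2 first.
- by apply/measurable_EFinP; exact: measurableT_comp.
- by rewrite lee_fin divr_ge0 ?powR_ge0// ltW.
apply: lte_mul_pinfty; [exact: integral_ge0| |exact: ltry].
have /integrableP[_ h] := iF; rewrite integral_mkcond in h.
rewrite ge0_fin_numE ?integral_ge0//; apply: le_lt_trans h.
rewrite le_eqVlt; apply/orP; left; apply/eqP; apply: eq_integral => y _.
by rewrite !patchE; case: ifP => //=; rewrite normr0.
Qed.

Lemma frac_int_integrand rho f x : Lam x ->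
  frac_int rho f x = (Euler_Gamma rho)^-1 * Rintegral leb setT (fun y => frac_integrand rho f
    (x, y)).
Proof.
rewrite LamE => /andP[x1 x2]; congr (_ * _); rewrite Rintegral_mkcond.
apply: eq_Rintegral => y _;
  rewrite /frac_integrand /frac_kernel !patchE !mem_setE /= !in_itv /= x1 /=.
have [xy|] := ltP x y => /=; last by rewrite mulr0.
have -> /= : -1 < y by exact: lt_trans xy.
by case: ifP; rewrite ?mul0r// -powRN opprB.
Qed.

Lemma frac_int_integrable_Lam rho f : 0 < rho -> integrable_Lam f ->
  integrable_Lam (frac_int rho f).
Proof.
move=> rho0 iF; have iK := integrable_frac_integrand rho0 iF.
pose F := fubini_F (@lebesgue_measure R) (EFin \o frac_integrand rho f).
have integrable_LamF : leb.-integrable Lam F.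
  apply: (@integrableS _ _ _ leb setT) => //; first exact: measurable_Lam.
  exact: integrable_fubini_F.
have mF : measurable_fun Lam F by exact: measurable_int integrable_LamF.
apply: (@eq_integrable_Lam _ (fun x => (Euler_Gamma rho)^-1 * fine (F x))).
  by move=> x /frac_int_integrand ->.
apply: integrable_LamZ; apply: (le_integrable _ _ _ integrable_LamF);
  first exact: measurable_Lam.
  by apply/measurable_EFinP; exact: (measurableT_comp (fine_measurable measurableT)).
by move=> x _ /=; case: (F x) => //= ; rewrite normr0 leey.
Qed.

(** The integral splits at each x where both integrands are integrable in y; Fubini's theorem grants
    this for almost every x. *)
Lemma frac_intB rho f g : 0 < rho -> integrable_Lam f -> integrable_Lam g ->
  {ae leb, forall x, Lam x -> frac_int rho (f \- g) x = frac_int rho f x - frac_int rho g x}.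
Proof.
move=> rho0 iF ig.
have af := ae_integrable1 (integrable_frac_integrand rho0 iF).
have ag := ae_integrable1 (integrable_frac_integrand rho0 ig).
apply: filterS2 af ag => x kf kg Lx.
rewrite !frac_int_integrand// -mulrBr -RintegralB//; congr (_ * _).
apply: eq_Rintegral => y _; rewrite /frac_integrand /= -mulrBl; congr (_ * _).
by rewrite !patchE; case: ifP => //; rewrite subr0.
Qed.

End FractionalIntegral.

(** * The Galerkin error *)

Section GalerkinEstimate.
Context {R : realType}.
Implicit Types (f g h u v phi : R -> R) (p q : {poly R}).

Lemma wL2normE f (W : R -> R) : integrable_Lam (fun x => f x ^+ 2 * W x) ->
  wL2norm W f = (int_Lam (fun x => f x ^+ 2 * W x) `^ 2^-1)%:E.
Proof. by move=> h; rewrite /wL2norm -int_LamE. Qed.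

Lemma jacobi_weight_nat k (x : R) : Lam x ->
  jacobi_weight k%:R k%:R x = (omega ^+ k).[x].
Proof.
rewrite LamE => /andP[x1 x2]; rewrite /jacobi_weight !powR_mulrn; [|lra..].
by rewrite -exprMn horner_exp omegaE; congr (_ ^+ _); ring.
Qed.

Lemma omega_exp_ge0 k (x : R) : Lam x -> 0 <= (omega ^+ k).[x].
Proof.
by rewrite LamE => /andP[x1 x2]; rewrite horner_exp exprn_ge0// omegaE; nra.
Qed.

(** The sign s lets one statement serve both estimates, with g a signed [D_+^(m-mu) u] or the
    derivative of f. *)
Lemma projection_bound k N h g q (s : R) : (k <= N)%N -> (0 < N)%N ->
  sqint h -> measurable_fun Lam g -> s ^+ 2 = 1 -> is_projection N h q ->
  (forall phi, test_function phi -> L2dot h (derive1n k phi) = s * L2dot g phi) ->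
  (L2norm (fun x => (q.[x] - h x)%R) <=
   ((k ^ k)%:R * N%:R `^ (- k%:R))%:E * wL2norm (jacobi_weight k%:R k%:R) g)%E.
Proof.
move=> kN N0 sh mg s1 prq hg.
have N0r : 0 < N%:R :> R by rewrite ltr0n.
have c0 : 0 < (k ^ k)%:R :> R by rewrite ltr0n expn_gt0; case: (k).
have C0 : 0 < (k ^ k)%:R * N%:R `^ (- k%:R) :> R by rewrite mulr_gt0// powR_gt0.
have [|gfin] := eqVneq (wL2norm (jacobi_weight k%:R k%:R) g) +oo%E.
  by move=> ->; rewrite gt0_muley ?leey// lte_fin.
have mwk : measurable_fun Lam (horner (omega ^+ k : {poly R})).
  by apply: continuous_meas => x; exact: continuous_horner.
have ig : integrable_Lam (fun x => g x ^+ 2 * jacobi_weight k%:R k%:R x).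
  apply/wL2norm_lty => //.
  - by apply: eq_meas mwk => x Lx; rewrite jacobi_weight_nat.
  - by move=> x Lx; rewrite jacobi_weight_nat ?omega_exp_ge0.
  - by rewrite lt_neqAle gfin leey.
have igw : integrable_Lam (fun x => g x ^+ 2 * (omega ^+ k).[x]).
  by apply: eq_integrable_Lam ig => x Lx; rewrite jacobi_weight_nat.
pose sq x : R := Num.sqrt (omega ^+ k).[x].
have csq : continuous sq.
  move=> x; apply: (continuous_comp (f := horner (omega ^+ k))); first exact: continuous_horner.
  exact: sqrt_continuous.
(* The weight omega^k is split evenly: one square root makes g an unweighted L^2 function, the other
   goes with p^(k). *)
pose gam x := (-1) ^+ k * s * (g x * sq x).
have sgs : sqint (fun x => g x * sq x).
  split; first by apply: measurable_funM => //; exact: continuous_meas.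
  apply: eq_integrable_Lam igw => x Lx; rewrite exprMn; congr (_ * _).
  by rewrite sqr_sqrtr// omega_exp_ge0.
have sgam : sqint gam by exact: sqintZ.
have Lgam : int_Lam (fun x => gam x ^+ 2) = int_Lam (fun x => g x ^+ 2 * (omega ^+ k).[x]).
  apply: eq_int_Lam => x Lx; rewrite /gam !exprMn s1 mulr1 sqr_sqrtr ?omega_exp_ge0//.
  by rewrite -exprM mulnC exprM sqrrN !expr1n mul1r.
have key p : L2dot h (horner (jacobi_op k p)) =
    int_Lam (fun x => gam x * (Num.sqrt (omega ^+ k).[x] * p^`(k).[x])).
  have sr : sqint (fun x => sq x * p^`(k).[x]).
    apply: continuous_sqint => x; apply: cvgM; [exact: csq|exact: continuous_horner].
  have e x : Lam x -> g x * (omega ^+ k * p^`(k)).[x] = g x * sq x * (sq x * p^`(k).[x]).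
    by move=> Lx; rewrite hornerM -[(omega ^+ k).[x]]sqr_sqrtr ?omega_exp_ge0// -/(sq x); ring.
  have ie : integrable_Lam (fun x => g x * (omega ^+ k * p^`(k)).[x]).
    by apply: eq_integrable_Lam (sqintM sgs sr) => x Lx; rewrite e.
  rewrite /jacobi_op L2dot_polyZ// (weak_deriv_pairing (sqint_integrable_Lam sh) mg ie hg)
    mulrA.
  by rewrite -int_LamZ//; apply: eq_int_Lam => x Lx; rewrite e// /gam -/(sq x); ring.
have := projection_error kN sh sgam key prq; rewrite Lgam.
set I := int_Lam (fun x => g x ^+ 2 * _) => EI.
have I0 : 0 <= I.
  by apply: int_Lam_ge0 => x Lx; rewrite mulr_ge0 ?sqr_ge0 ?omega_exp_ge0.
rewrite (wL2normE ig) (_ : int_Lam _ = I); last first.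
  by apply: eq_int_Lam => x Lx; rewrite jacobi_weight_nat.
have se : sqint (fun x => q.[x] - h x) by apply: sqintB => //; exact: sqint_poly.
rewrite /L2norm wL2normE; last first.
  by under eq_fun do rewrite mulr1; case: se.
rewrite -EFinM lee_fin (_ : int_Lam _ = int_Lam (fun x => (h x - q.[x]) ^+ 2)); last first.
  by apply: eq_int_Lam => x _; rewrite mulr1; ring.
rewrite !powR12_sqrt//; last by apply: int_Lam_ge0 => x _; exact: sqr_ge0.
set C := (k ^ k)%:R * _ in C0 *.
have -> : C = Num.sqrt (C ^+ 2) by rewrite sqrtr_sqr gtr0_norm.
rewrite -sqrtrM ?sqr_ge0// ler_wsqrtr// (le_trans EI)// mulrC ler_wpM2r//.
have l0 : 0 < (jacobi_eig k N)%:R :> R by rewrite ltr0n jacobi_eig_gt0.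
rewrite -[leLHS]mul1r ler_pdivrMr// /C powRN powR_mulrn ?ler0n// exprMn exprVn -exprM muln2.
rewrite -addnn -mulrA mulrCA -ler_pdivrMl ?invr_gt0 ?exprn_gt0// invrK mulr1.
(* What remains is N^(2k) <= (k^k)^2 lambda_N. The eigenvalue bound gives it with k^k in place of
   its square, and k^k >= 1. *)
rewrite -!natrX -!natrM ler_nat; apply: leq_trans (jacobi_eig_ge kN) _.
by rewrite leq_mul2r expnS expn1 leq_pmulr ?orbT// expn_gt0; case: (k).
Qed.


Lemma int_poly_1 : int_poly 1 = 2 :> R.
Proof.
rewrite /int_poly (@eq_int_Lam _ _ (cst 1)); last by move=> x _; rewrite hornerC.
rewrite Rintegral_cst; last exact: measurable_Lam.
by rewrite [X in fine X]mu_Lam mul1r.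
Qed.

Lemma galerkin_projection N (F : (R -> R) -> R) v vN dv p :
  variational_sol in_H10 F v -> is_weak_deriv 1 v dv -> sqint dv ->
  variational_sol (in_PN0 N) F vN ->
  (size p <= N.+1)%N -> (forall x, Lam x -> vN x = p.[x]) ->
  is_projection N dv p^`().
Proof.
move=> [vH hv] wdv sdv [[_ vNH] hvN] pN vNp.
have wp : is_weak_deriv 1 vN (horner p^`()).
  exact: (weak_deriv_classical vNp (is_derive_poly p) (@continuous_horner _ _)).
split; first by have := size_derivn_le 1 pN; rewrite derivn1 subn1.
move=> q qN; have sp := sqint_poly p^`().
have sd : sqint (fun x => dv x - p^`().[x]) by exact: sqintB.
have mean0 : L2dot (fun x => dv x - p^`().[x]) (horner 1) = 0.
  rewrite /L2dot (@eq_int_Lam _ _ (fun x => dv x - p^`().[x])); last first.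
    by move=> x _; rewrite hornerC mulr1.
  rewrite int_LamB; [|exact: sqint_integrable_Lam..].
  rewrite (H10_mean_deriv vH wdv); last exact: sqint_integrable_Lam.
  by rewrite (H10_mean_deriv vNH wp) ?subrr//; exact: sqint_integrable_Lam.
(* a is the mean of q over an interval of length 2, so q - a has a primitive W vanishing at both
   ends: an admissible test polynomial. Then q = W' + a, the Galerkin equations handle W', and the
   zero means handle the constant. *)
pose a : R := int_poly q / 2.
have [P dP sP] := poly_antideriv (q - a%:P).
pose W := P - (P.[-1])%:P.
have dW : W^`() = q - a%:P by rewrite derivB derivC subr0 dP.
have WN1 : W.[-1] = 0 by rewrite hornerD hornerN hornerC subrr.
have W1 : W.[1] = 0.
  have := int_poly_deriv W; rewrite WN1 subr0 dW int_polyB -alg_polyC int_polyZ => <-.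
  by rewrite int_poly_1 /a; field.
have WH : in_H10 (horner W).
  exact: (@in_H10_classical _ _ (horner W) (horner W^`()) _ (is_derive_poly W)
    (@continuous_horner _ _) WN1 W1).
have sW : (size W <= N.+1)%N.
  rewrite (leq_trans (size_polyD _ _))// geq_max size_polyN.
  rewrite (leq_trans (size_polyC_leq1 _))// andbT (leq_trans sP)// ltnS.
  rewrite (leq_trans (size_polyD _ _))// geq_max qN size_polyN.
  (* The constant a has size at most 1, which is within N unless q = 0, and then a = 0. *)
  rewrite /= /a; have [->|qn0] := eqVneq q 0;
    first by rewrite int_poly0 mul0r polyC0 size_poly0.
  by rewrite (leq_trans (size_polyC_leq1 _))// (leq_trans _ qN)// lt0n size_poly_eq0.
have wW : is_weak_deriv 1 (horner W) (horner W^`()).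
  exact: (@weak_deriv_classical _ _ (horner W) _ _ (is_derive_poly W) (@continuous_horner _ _)).
have e1 := hv _ _ _ WH wdv wW.
have e2 := hvN (horner W) _ _ (conj (ex_intro2 _ _ W sW (fun _ _ => erefl)) WH) wp wW.
have -> : q = W^`() + a *: 1 by rewrite dW alg_polyC subrK.
rewrite L2dot_polyD// L2dot_polyZ// mean0 mulr0 addr0.
by rewrite L2dot_subl ?e1 ?e2 ?subrr//; exact: sqint_poly.
Qed.

Lemma frac_power_integrable_Lam (mu : R) q u : mu <= 1 ->
  (forall x, Lam x -> u x = (1 - x) `^ (1 - mu) * q.[x]) -> integrable_Lam u.
Proof.
move=> leb' uE; apply: (@eq_integrable_Lam _ (fun x => (1 - x) `^ (1 - mu) * q.[x])).
  by move=> x Lx; rewrite uE.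
have [M qM] := continuous_Lam_bounded (@continuous_horner _ q).
apply: (@bounded_integrable_Lam _ (2 `^ (1 - mu) * M)).
  apply: measurable_funM.
    apply: (measurableT_comp (f := @powR R ^~ (1 - mu))) => //.
    exact: measurable_funB.
  by apply: continuous_meas => x; exact: continuous_horner.
move=> x Lx; rewrite normrM ler_pM ?qM// ger0_norm ?powR_ge0//.
move: Lx; rewrite LamE => /andP[x1 x2].
by apply: ge0_ler_powR; rewrite ?nnegrE; lra.
Qed.

Lemma frac_int_weak_derivB (rho : R) f g df dg : 0 < rho -> integrable_Lam f ->
  integrable_Lam g ->
  is_weak_deriv 1 (frac_int rho f) df -> is_weak_deriv 1 (frac_int rho g) dg ->
  sqint df -> sqint dg ->
  is_weak_deriv 1 (frac_int rho (f \- g)) (fun x => df x - dg x).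
Proof.
move=> rho0 iF ig [_ [ldf hdf]] [_ [ldg hdg]] sdf sdg.
have ifg : integrable_Lam (f \- g) by exact: integrable_LamB.
split; first exact/integrable_Lam_locally/frac_int_integrable_Lam.
split; first exact: locally_integrableB.
move=> phi tp.
have sphi : sqint phi by apply: continuous_sqint;
  exact: (@test_function_continuous _ phi 0%N tp).
have cp' : continuous (derive1n 1 phi) by exact: (@test_function_continuous _ phi 1%N tp).
have [B hB] := continuous_Lam_bounded cp'.
have ip h : integrable_Lam h -> integrable_Lam (fun x => h x * derive1n 1 phi x).
  move=> ih; apply: (integrable_Lam_le _ (integrable_LamZ B (integrable_Lam_norm ih))).
    by apply: measurable_funM; [exact: integrable_Lam_meas|exact: continuous_meas].
  by move=> x Lx; rewrite normrM mulrC ler_wpM2r// hB.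
rewrite L2dot_subl// hdf// hdg// -mulrBr -int_LamB; [|exact/ip/frac_int_integrable_Lam..].
congr (_ * _); apply: int_Lam_ae.
- exact: integrable_Lam_meas (integrable_LamB (ip _ (frac_int_integrable_Lam rho0 iF)) (ip _
  (frac_int_integrable_Lam rho0 ig))).
- exact: integrable_Lam_meas (ip _ (frac_int_integrable_Lam rho0 ifg)).
- have [A [mA A0 sA]] := frac_intB rho0 iF ig.
  exists A; split => // x nx; apply: sA => h; apply: nx => Lx.
  by rewrite h// mulrBl.
Qed.

End GalerkinEstimate.

Theorem theorem2 (R : realType) (nu mu : R) (hnu : 1 < nu < 2)
    (hmu : mu = 2 - nu) (m : nat) (hm : (1 <= m)%N) :
  exists2 c : R, 0 < c &
  forall (f : (R -> R) -> R) (u : R -> R) (N : nat) (uN : R -> R),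
    in_Hm1 f ->
    (@lebesgue_measure R).-integrable Lam (EFin \o u) ->
    variational_sol in_H10 f (frac_int mu u) ->
    (1 <= N)%N -> (m <= N.+1)%N ->
    in_VN mu N uN ->
    variational_sol (in_PN0 N) f (frac_int mu uN) ->
    (forall g : R -> R,
       is_RL_deriv (m%:R - mu) u g ->
       in_L2 (fun x => (1 - x ^+ 2) `^ ((m%:R - 1) / 2) * g x) ->
       exists2 e : R -> R, is_RL_deriv (1 - mu) (u \- uN) e &
         (L2norm e <= (c * N%:R `^ (1 - m%:R))%:E *
                      wL2norm (jacobi_weight (m%:R - 1) (m%:R - 1)) g)%E) /\
    ((2 <= m)%N -> forall g : R -> R,
       is_distr_deriv (m - 2) f g ->
       in_wL2 (jacobi_weight (m%:R - 1) (m%:R - 1)) g ->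
       exists2 e : R -> R, is_RL_deriv (1 - mu) (u \- uN) e &
         (L2norm e <= (c * N%:R `^ (1 - m%:R))%:E *
                      wL2norm (jacobi_weight (m%:R - 1) (m%:R - 1)) g)%E).
Proof.
(* With m = k + 1 the constant is k^k, which equals 1 for k = 0. *)
case: m hm => // k _; exists (k ^ k)%:R; first by rewrite ltr0n expn_gt0; case: (k).
move=> f u N uN _ iu hv N0 kN [[psi _ uNE] _] hvN.
have mu0 : 0 < mu by rewrite hmu; case/andP: hnu => ? ?; lra.
have mu_lt1 : mu < 1 by rewrite hmu; case/andP: hnu => ? ?; lra.
have iuN : integrable_Lam uN by exact: (frac_power_integrable_Lam (ltW mu_lt1) uNE).
have k1 : k.+1%:R - 1 = k%:R :> R by rewrite -natr1 addrK.
have k1N : 1 - k.+1%:R = - k%:R :> R by rewrite -natr1 opprD addrCA subrr addr0.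
have [[[_ [dv wdv /in_L2_sqint sdv]] _] hvv] := hv.
have [[[p pN vNp] _] _] := hvN.
have wp : is_weak_deriv 1 (frac_int mu uN) (horner p^`()).
  exact: (weak_deriv_classical vNp (is_derive_poly p) (@continuous_horner _ _)).
have prj := galerkin_projection hv wdv sdv hvN pN vNp.
have hRL : is_RL_deriv (1 - mu) (u \- uN) (fun x => p^`().[x] - dv x).
  (* The order 1 - mu lies in (0,1), so D_+^(1-mu) is -D I_+^mu and the error is -(Dv - Dv_N). *)
  exists 1%N; split; [by []|lra|lra|].
  have -> : 1%:R - (1 - mu) = mu by lra.
  have -> : (fun x => (-1) ^+ 1 * (p^`().[x] - dv x)) = fun x => dv x - p^`().[x].
    by apply/funext => x; ring.
  by apply: frac_int_weak_derivB => //; exact: sqint_poly.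
rewrite k1 k1N; split.
  move=> g [j [j0 j1 j2 [_ [lg hg]]]] _.
  exists (fun x => p^`().[x] - dv x) => //.
  (* From j - 1 <= k + 1 - mu < j and 0 < mu < 1 the integer j is forced, and the fractional
     integral involved is again I_+^mu u = v. *)
  have jE : j = k.+1.
    apply/eqP; rewrite eqn_leq -ltnS -!(ltr_nat R) -!natr1 in k1 j1 j2 *.
    by apply/andP; split; lra.
  subst j.
  have -> : wL2norm (jacobi_weight k%:R k%:R) g =
      wL2norm (jacobi_weight k%:R k%:R) (fun x => (-1) ^+ k.+1 * g x).
    rewrite /wL2norm; congr (_ `^ _)%E; apply: eq_integral => x _.
    by rewrite exprMn -exprM mulnC exprM sqrrN !expr1n mul1r.
  (* The minus sign comes from (Dv, D^k phi) = -(v, D^(k+1) phi), the power from the weak derivative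
     of order k + 1. *)
  apply: (@projection_bound R k N dv _ _ (- (-1) ^+ k.+1)) => //.
  - by case: lg.
  - by rewrite sqrrN -exprM mulnC exprM sqrrN !expr1n.
  move=> phi tp; rewrite hg// subKr mulrA mulNr -exprMn mulrNN mulr1 expr1n.
  case: wdv => _ [_ ->]; last exact: test_function_derive1n.
  by rewrite expr1 derive1n1 -derive1nS.
move=> k2 g [lg hg] _.
exists (fun x => p^`().[x] - dv x) => //.
apply: (@projection_bound R k N dv _ _ ((-1) ^+ (k.+1 - 2))) => //.
- by case: lg.
- by rewrite -exprM mulnC exprM sqrrN !expr1n.
move=> phi tp; rewrite hg// mulrA -exprMn mulrNN mulr1 expr1n mul1r.
(* The variational equation with w = D^(k-1) phi, again a test function, gives (Dv, D^k phi) =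
   f(D^(k-1) phi). *)
have tp' := test_function_derive1n (k.+1 - 2) tp.
rewrite -(hvv _ _ _ (in_H10_test tp') wdv (weak_deriv_test tp')).
by rewrite derive1n1 -derive1nS; congr (L2dot _ (derive1n _ _)); lia.
Qed.
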